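(* Let $R=K[X_1,\dots,X_d]$ be a polynomial ring in $d$ variables over a field $K$, let $m_R=(X_1,\dots,X_d)$, let $I_1,\dots,I_r$ be monomial ideals of $R$ and let $J$ be any ideal of $R$. Then the symbolic multi-Rees algebra $S_J(I_1,\dots,I_r)$ is a Noetherian $\mathbb{N}^r$-graded $R$-algebra. If $J=m_R$, there exists a piecewise quasi-polynomial $F:\mathbb{N}^r\to\mathbb{N}$ such that $$l_R\left(H^0_{m_R}\left(\frac{R}{I_1^{n_1}\cdots I_r^{n_r}}\right)\right)=F(n_1,\dots,n_r)$$ for all $n_1,\dots,n_r\gg 0$. Moreover, this length function is bounded above, for all $n_1,\dots,n_r\gg0$, by a numerical polynomial in $n_1,\dots,n_r$ of total degree at most $d$.
   Context: For ideals $I_1,\dots,I_r,J$ of a ring $R$ and $\mathbf{n}=(n_1,\dots,n_r)\in\mathbb{N}^r$ write $\mathbf{I}^{\mathbf{n}}=I_1^{n_1}\cdots I_r^{n_r}$ and $\mathbf{t}^{\mathbf{n}}=t_1^{n_1}\cdots t_r^{n_r}$ with $t_i$ indeterminates. The symbolic multi-Rees algebra is $S_J(I_1,\dots,I_r)=\bigoplus_{\mathbf{n}\in\mathbb{N}^r}(\mathbf{I}^{\mathbf{n}}:_R J^\infty)\mathbf{t}^{\mathbf{n}}\subseteq R[t_1,\dots,t_r]$, where $I:_RJ^\infty=\bigcup_{k}(I:_RJ^k)$. $H^0_{m_R}(N)$ denotes the submodule of elements of $N$ annihilated by a power of $m_R$. A numerical polynomial is a polynomial in $\mathbb{Q}[n_1,\dots,n_r]$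 taking integer values at integer points. A map $\sigma:\mathbb{N}^r\to\mathbb{Q}$ is periodic if there is $\alpha\in\mathbb{N}$ with $\sigma(\mathbf{n}+\alpha\mathbf{e}_i)=\sigma(\mathbf{n})$ for all $\mathbf{n}$ and all $i$ ($\mathbf{e}_i$ the standard unit vectors). A quasi-polynomial is a function $f:\mathbb{N}^r\to\mathbb{Q}$ of the form $f(\mathbf{n})=\sum_{|\mathbf{i}|\le D}\sigma_{\mathbf{i}}(\mathbf{n})n_1^{i_1}\cdots n_r^{i_r}$ with all $\sigma_{\mathbf{i}}$ periodic. A piecewise quasi-polynomial is a function $F$ on $\mathbb{N}^r$ for which there is a finite partition $\mathbb{N}^r=\bigcup_{i=1}^t(P_i\cap\mathbb{N}^r)$ with $P_i$ polyhedra (not necessarily full-dimensional) and quasi-polynomials $f_i$ with $F=f_i$ on $P_i\cap\mathbb{N}^r$. *)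

(* Defs.v *)
From HB Require Import structures.
From mathcomp Require Import all_boot all_order all_algebra.
From mathcomp Require Import mpoly.
From Stdlib Require Rdefinitions Raxioms.

Set Implicit Arguments.
Unset Strict Implicit.
Unset Printing Implicit Defensive.

Import Order.TTheory GRing.Theory Num.Theory.
Local Open Scope ring_scope.

Section Ideals.
Variable R : comNzRingType.

Definition is_ideal (I : R -> Prop) : Prop :=
  [/\ I 0, (forall a b, I a -> I b -> I (a + b)) & (forall c a, I a -> I (c * a))].

Definition gen_ideal (S : R -> Prop) : R -> Prop :=
  fun f => forall L, is_ideal L -> (forall s, S s -> L s) -> L f.

Definition unit_ideal : R -> Prop := fun _ => True.

Definition ideal_mul (I J : R -> Prop) : R -> Prop :=
  gen_ideal (fun f => exists a b, [/\ I a, J b & f = a * b]).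

Fixpoint ideal_pow (I : R -> Prop) (n : nat) : R -> Prop :=
  match n with
  | 0 => unit_ideal
  | n'.+1 => ideal_mul (ideal_pow I n') I
  end.

Definition ideal_multipow (r : nat) (Is : 'I_r -> R -> Prop) (n : 'I_r -> nat)
  : R -> Prop :=
  foldr (fun i acc => ideal_mul acc (ideal_pow (Is i) (n i))) unit_ideal (enum 'I_r).

Definition ideal_colon (I J : R -> Prop) : R -> Prop :=
  fun f => forall g, J g -> I (f * g).

Definition saturation (I J : R -> Prop) : R -> Prop :=
  fun f => exists k : nat, ideal_colon I (ideal_pow J k) f.

(* Submodules of the R-module N/I (I <= N ideals) are the ideals L with
   I <= L <= N.  A chain of length k in N/I from 0 to N/I is a strictly
   increasing chain of ideals I = L_0 < L_1 < ... < L_k = N. *)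
Definition quot_chain (I N : R -> Prop) (k : nat) : Prop :=
  exists L : nat -> R -> Prop,
    [/\ (forall j, (j <= k)%N -> is_ideal (L j)),
        (forall f, L 0%N f <-> I f),
        (forall f, L k f <-> N f) &
        (forall j, (j < k)%N ->
           (forall f, L j f -> L j.+1 f) /\ (exists f, L j.+1 f /\ ~ L j f))].

Definition quot_length (I N : R -> Prop) (k : nat) : Prop :=
  quot_chain I N k /\ (forall k', quot_chain I N k' -> (k' <= k)%N).

Definition is_subring (S : R -> Prop) : Prop :=
  [/\ S 0, S 1, (forall a b, S a -> S b -> S (a - b)) &
      (forall a b, S a -> S b -> S (a * b))].

Definition is_ideal_of (S L : R -> Prop) : Prop :=
  [/\ (forall x, L x -> S x), L 0, (forall a b, L a -> L b -> L (a + b)) &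
      (forall s x, S s -> L x -> L (s * x))].

Definition noetherian_subring (S : R -> Prop) : Prop :=
  forall L, is_ideal_of S L ->
    exists gs : seq R,
      (forall g, List.In g gs -> L g) /\
      (forall x, L x -> exists cs : seq R,
          [/\ size cs = size gs, (forall c, List.In c cs -> S c) &
              x = \sum_(i < size gs) cs`_i * gs`_i]).
End Ideals.

Definition max_homog_ideal (K : fieldType) (d : nat) : {mpoly K[d]} -> Prop :=
  gen_ideal (fun f => exists i : 'I_d, f = 'X_i).

Definition monomial_ideal (K : fieldType) (d : nat) (I : {mpoly K[d]} -> Prop)
  : Prop :=
  exists M : 'X_{1..d} -> Prop,
    forall f, I f <-> gen_ideal (fun g => exists m, M m /\ g = 'X_[m]) f.

(* The symbolic multi-Rees algebra S_J(I_1,...,I_r), as a subset of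
   R[t_1,...,t_r] = {mpoly R[r]}: the coefficient of t^n lies in I^n :_R J^oo. *)
Definition sym_multi_rees (K : fieldType) (d r : nat)
  (Is : 'I_r -> {mpoly K[d]} -> Prop) (J : {mpoly K[d]} -> Prop)
  : {mpoly {mpoly K[d]}[r]} -> Prop :=
  fun P => forall n : 'X_{1..r},
    saturation (ideal_multipow Is (fun i => n i)) J (P@_n).

Definition unit_vec (r : nat) (i : 'I_r) (a : nat) (n : 'I_r -> nat) : 'I_r -> nat :=
  fun j => if j == i then (n j + a)%N else n j.

Definition periodic (r : nat) (sigma : ('I_r -> nat) -> rat) : Prop :=
  exists alpha : nat, (0 < alpha)%N /\
    forall (n : 'I_r -> nat) (i : 'I_r), sigma (unit_vec i alpha n) = sigma n.

Definition quasi_poly (r : nat) (f : ('I_r -> nat) -> rat) : Prop :=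
  exists (D : nat) (sigma : {ffun 'I_r -> 'I_D.+1} -> ('I_r -> nat) -> rat),
    (forall e, periodic (sigma e)) /\
    forall n : 'I_r -> nat,
      f n = \sum_(e : {ffun 'I_r -> 'I_D.+1} | (\sum_(j < r) (e j : nat) <= D)%N)
              sigma e n * \prod_(j < r) ((n j)%:R ^+ e j).

(* a (real) polyhedron: finite intersection of closed half-spaces
   { x | a . x <= b } with a in R^r, b in R *)
Definition polyhedron (r : nat) : Type :=
  list (('I_r -> Rdefinitions.R) * Rdefinitions.R).

Definition lin_form (r : nat) (a : 'I_r -> Rdefinitions.R) (n : 'I_r -> nat)
  : Rdefinitions.R :=
  List.fold_right Rdefinitions.Rplus (Rdefinitions.IZR BinNums.Z0)
    (List.map (fun j => Rdefinitions.Rmult (a j) (Raxioms.INR (n j))) (enum 'I_r)).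

Definition in_polyhedron (r : nat) (P : polyhedron r) (n : 'I_r -> nat) : Prop :=
  forall h, List.In h P -> Rdefinitions.Rle (lin_form h.1 n) h.2.

Definition piecewise_quasi_poly (r : nat) (F : ('I_r -> nat) -> rat) : Prop :=
  exists (t : nat) (P : 'I_t -> polyhedron r) (f : 'I_t -> ('I_r -> nat) -> rat),
    [/\ (forall i, quasi_poly (f i)),
        (forall n, exists i, in_polyhedron (P i) n),
        (forall n i i', in_polyhedron (P i) n -> in_polyhedron (P i') n -> i = i') &
        (forall i n, in_polyhedron (P i) n -> F n = f i n)].

Definition numerical_poly (r : nat) (P : {mpoly rat[r]}) : Prop :=
  forall z : 'I_r -> int, exists k : int, P.@[fun i => (z i)%:~R] = k%:~R.

(* Main.v *)
(** The [I_i] are monomial, so the statement is about exponents.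
    The pairs [(n, m)] with [X^m] in [I^n] form a finitely generated submonoid
    of [N^(r+d)].  As associated primes of monomial ideals are monomial,
    [I^n : J^oo] only depends on the monomials occurring in elements of [J], and
    the exponents of the symbolic algebra form a finite intersection of colon
    monoids [{x | exists k, x + k mu \in M}].  These are again finitely generated,
    being projections of solution monoids of linear systems (Dickson), and
    division by leading terms gives the Noetherian property.

    For [J = m_R] the length counts the monomials in [I^n : m_R^oo] outside
    [I^n]; all their exponents are below [C |n|], which gives the bound
    [(C |n|)^d].  The indicator function of a finitely generated monoid is a
    finite sum of products of indicators of affine inequalities, because the
    minimal representations of its elements form the complement of a finite
    union of orthants.  Functions built from coordinates and from indicators of
    affine inequalities and congruences are closed under summation over an
    interval with affine bounds, and they are piecewise quasi-polynomial. *)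

Require Import Defs.
From HB Require Import structures.
From mathcomp Require Import all_boot all_order all_algebra.
From mathcomp Require Import mpoly.
From mathcomp Require Import zify ring.
From Stdlib Require Import Classical ClassicalEpsilon FunctionalExtensionality.
From Stdlib Require Import PropExtensionality.
From Stdlib Require RIneq.
Import Order.TTheory GRing.Theory Num.Theory.
Set Implicit Arguments.
Unset Strict Implicit.
Unset Printing Implicit Defensive.
Local Open Scope ring_scope.

(** * Finitely generated monoids of exponent vectors *)

Lemma list_In_nth (T : Type) (x0 x : T) (s : seq T) :
  List.In x s -> exists2 i, (i < size s)%N & nth x0 s i = x.
Proof.
elim: s => //= a s IH [->|/IH [i ilt <-]]; first by exists 0%N.
by exists i.+1.
Qed.

Lemma list_nth_In (T : Type) (x0 : T) (s : seq T) i :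
  (i < size s)%N -> List.In (nth x0 s i) s.
Proof. by elim: s i => //= a s IH [|i] ilt; [left | right; apply: IH]. Qed.

(** Induction on the number of coordinates. A finite set [s0] for the first [g] coordinates serves
    every vector whose coordinate [g] is at least the maximum [N] attained on [s0]; each of the
    finitely many slices below [N] is covered by the induction hypothesis. *)
Lemma dickson_nat (g : nat) (U : (nat -> nat) -> Prop) :
  exists s : seq (nat -> nat), (forall v, List.In v s -> U v) /\
    forall u, U u ->
      exists v, List.In v s /\ forall i, (i < g)%N -> (v i <= u i)%N.
Proof.
elim: g U => [|g IH] U.
  case: (classic (exists u, U u)) => [[u0 Uu0]|nU].
    exists [:: u0]; split=> [v [<-//|[]]|u Uu].
    by exists u0; split; [left|].
  by exists [::]; split=> // u Uu; case: nU; exists u.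
have [s0 [s0U s0P]] := IH U.
have [N NP] : exists N, forall v, List.In v s0 -> (v g <= N)%N.
  elim: s0 {s0U s0P} => [|a s [N NP]]; first by exists 0%N.
  exists (maxn (a g) N) => v [<-|/NP]; first exact: leq_maxl.
  by move=> h; apply: leq_trans h (leq_maxr _ _).
have [s1 [s1U s1P]] : exists s, (forall v, List.In v s -> U v) /\
    forall u, U u -> (u g < N)%N ->
      exists v, List.In v s /\ forall i, (i < g.+1)%N -> (v i <= u i)%N.
  elim: N {NP} => [|N [s [sU sP]]]; first by exists [::].
  have [s2 [s2U s2P]] := IH (fun u => U u /\ u g = N).
  exists (s2 ++ s); split=> [v|u Uu].
    by case/List.in_app_iff => [/s2U[]|/sU].
  rewrite ltnS leq_eqVlt => /orP[/eqP ug|ult].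
    have [v [vin vle]] := s2P u (conj Uu ug).
    have [_ vg] := s2U v vin.
    exists v; split; first by apply/List.in_app_iff; left.
    move=> i; rewrite ltnS leq_eqVlt => /orP[/eqP->|/vle//].
    by rewrite vg ug.
  have [v [vin vle]] := sP u Uu ult.
  by exists v; split=> //; apply/List.in_app_iff; right.
exists (s0 ++ s1); split=> [v|u Uu].
  by case/List.in_app_iff => [/s0U|/s1U].
case: (ltnP (u g) N) => ug.
  have [v [vin vle]] := s1P u Uu ug.
  by exists v; split=> //; apply/List.in_app_iff; right.
have [v [vin vle]] := s0P u Uu.
exists v; split; first by apply/List.in_app_iff; left.
move=> i; rewrite ltnS leq_eqVlt => /orP[/eqP->|/vle//].
exact: leq_trans (NP v vin) ug.
Qed.

Lemma dickson (T : finType) (U : (T -> nat) -> Prop) :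
  exists (k : nat) (v : 'I_k -> T -> nat), (forall i, U (v i)) /\
    forall u, U u -> exists i, forall t, (v i t <= u t)%N.
Proof.
have [s [sU sP]] :=
  dickson_nat #|T| (fun w => U (fun t => w (enum_rank t : nat))).
exists (size s), (fun i t => nth (fun _ => 0%N) s i (enum_rank t)).
split=> [i|u Uu]; first exact: sU (list_nth_In _ (ltn_ord i)).
pose w i := if insub i is Some j then u (enum_val (j : 'I_#|T|)) else 0%N.
have wE : (fun t => w (enum_rank t : nat)) = u.
  apply: functional_extensionality => t; rewrite /w.
  by rewrite (valK (enum_rank t)) enum_rankK.
have [v [vin vle]] := sP w (eq_ind_r U Uu wE).
have [i ilt vi] := list_In_nth (fun _ => 0%N) vin.
exists (Ordinal ilt) => t /=; rewrite vi -[u t](congr1 (@^~ t) wE).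
exact: vle.
Qed.

Definition vadd (T : Type) (x y : T -> nat) : T -> nat := fun t => (x t + y t)%N.
Definition vzero (T : Type) : T -> nat := fun=> 0%N.

Definition comb (T : Type) (G : nat) (s : 'I_G -> T -> nat) (l : 'I_G -> nat)
  : T -> nat := fun t => (\sum_(i < G) l i * s i t)%N.

Definition fg (T : Type) (M : (T -> nat) -> Prop) : Prop :=
  exists (G : nat) (s : 'I_G -> T -> nat), forall x,
    M x <-> exists l, x = comb s l.

Lemma comb_add (T : Type) G (s : 'I_G -> T -> nat) l l' :
  comb s (vadd l l') = vadd (comb s l) (comb s l').
Proof.
apply: functional_extensionality => t.
by rewrite /comb /vadd -big_split; apply: eq_bigr => i _; rewrite mulnDl.
Qed.

Lemma comb_zero (T : Type) G (s : 'I_G -> T -> nat) :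
  comb s (@vzero 'I_G) = @vzero T.
Proof. by apply: functional_extensionality => t; rewrite /comb big1. Qed.

Lemma comb_comb (T : Type) G G' (s : 'I_G -> T -> nat)
    (s' : 'I_G' -> 'I_G -> nat) l :
  comb s (comb s' l) = comb (fun j => comb s (s' j)) l.
Proof.
apply: functional_extensionality => t; rewrite /comb.
under eq_bigr => i _ do rewrite big_distrl /=.
rewrite exchange_big; apply: eq_bigr => j _; rewrite big_distrr /=.
by apply: eq_bigr => i _; rewrite mulnA.
Qed.

Lemma comb_delta (T : Type) G (s : 'I_G -> T -> nat) i :
  comb s (fun j => (j == i : nat)) = s i.
Proof.
apply: functional_extensionality => t; rewrite /comb (bigD1 i) //= eqxx mul1n.
by rewrite big1 ?addn0 // => j /negbTE ->.
Qed.

Lemma vadd_subK (T : Type) (x y : T -> nat) :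
  (forall t, (x t <= y t)%N) -> y = vadd x (fun t => (y t - x t)%N).
Proof.
by move=> h; apply: functional_extensionality => t; rewrite /vadd subnKC.
Qed.

(** By Dickson's lemma finitely many nonzero elements of [M] lie below all others. Subtracting one
    of them stays in [M] by the last hypothesis and lowers the coordinate sum, so induction on that
    sum applies. Solution monoids of homogeneous linear equations are of this kind. *)
Lemma fg_full (T : finType) (M : (T -> nat) -> Prop) :
  M (@vzero T) -> (forall x y, M x -> M y -> M (vadd x y)) ->
  (forall x y, M x -> M (vadd x y) -> M y) -> fg M.
Proof.
move=> M0 MD MB.
have [k [v [vU vP]]] := dickson (fun x : T -> nat => M x /\ x <> @vzero T).
exists k, v => x; split; last first.
  case=> l ->; rewrite /comb.
  have -> : (fun t => (\sum_(i < k) l i * v i t)%N) =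
      \big[@vadd T/@vzero T]_(i < k) (fun t => (l i * v i t)%N).
    apply: functional_extensionality => t.
    by elim/big_rec2: _ => // i a b _ ->.
  elim/big_ind: _ => // i _; elim: (l i) => [|n IH]; first exact: M0.
  have -> : (fun t => (n.+1 * v i t)%N) = vadd (v i) (fun t => (n * v i t)%N).
    by apply: functional_extensionality => t; rewrite mulSn.
  by apply: MD => //; case: (vU i).
have [n] := ubnP (\sum_t x t)%N; elim: n x => // n IH x xn Mx.
case: (classic (x = @vzero T)) => [->|xn0].
  by exists (@vzero _); rewrite comb_zero.
have [i vx] := vP x (conj Mx xn0).
have xE := vadd_subK vx.
set y := (fun t => _) in xE.
have My : M y by apply: (MB (v i)); rewrite -?xE //; case: (vU i).
have [t0 vt0] : exists t, (0 < v i t)%N.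
  case: (vU i) => _ vi0; apply: NNPP => h; apply: vi0.
  apply: functional_extensionality => t; apply/eqP; rewrite -leqn0 leqNgt.
  by apply/negP => vt; apply: h; exists t.
have yn : (\sum_t y t < n)%N.
  rewrite -ltnS; apply: leq_trans xn; rewrite ltnS xE big_split /=.
  rewrite -[X in (X < _)%N]add0n ltn_add2r (bigD1 t0) //=; lia.
have [l yE] := IH y yn My.
exists (vadd (fun j => (j == i : nat)) l).
by rewrite comb_add comb_delta -yE -xE.
Qed.

Lemma fg_reindex (T T' : Type) (h : T' -> T) (M : (T -> nat) -> Prop) :
  fg M -> fg (fun y => exists2 x, M x & y = x \o h).
Proof.
case=> G [s sP]; exists G, (fun i => s i \o h) => y; split.
  by case=> x /sP [l ->] ->; exists l.
by case=> l ->; exists (comb s l) => //; apply/sP; exists l.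
Qed.

Lemma fg_comb (T : Type) G (s : 'I_G -> T -> nat) (M : ('I_G -> nat) -> Prop) :
  fg M -> fg (fun y => exists2 x, M x & y = comb s x).
Proof.
case=> G' [s' sP]; exists G', (fun i => comb s (s' i)) => y; split.
  by case=> x /sP [l ->] ->; exists l; rewrite comb_comb.
by case=> l ->; exists (comb s' l); [apply/sP; exists l | rewrite comb_comb].
Qed.

Lemma fg_ext (T : Type) (M M' : (T -> nat) -> Prop) :
  (forall x, M x <-> M' x) -> fg M -> fg M'.
Proof.
by move=> h [G [s sP]]; exists G, s => x; rewrite -h.
Qed.

(** Pairs of coefficient vectors with equal combinations form the solution monoid [W] of a linear
    system, to which [fg_full] applies. The intersection is the image of [W] under a projection
    followed by [comb s]. *)
Lemma fg_inter (T : Type) (M M' : (T -> nat) -> Prop) :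
  fg M -> fg M' -> fg (fun x => M x /\ M' x).
Proof.
move=> [G [s sP]] [G' [s' sP']].
pose W (z : 'I_G + 'I_G' -> nat) := comb s (z \o inl) = comb s' (z \o inr).
have WD x y : comb s (vadd x y \o inl) = vadd (comb s (x \o inl)) (comb s (y \o inl)).
  exact: comb_add.
have WD' x y :
    comb s' (vadd x y \o inr) = vadd (comb s' (x \o inr)) (comb s' (y \o inr)).
  exact: comb_add.
have Wfg : fg W.
  apply: fg_full; rewrite /W.
  - exact: etrans (comb_zero s) (esym (comb_zero s')).
  - by move=> x y; rewrite WD WD' => -> ->.
  - move=> x y; rewrite WD WD' => -> h; apply: functional_extensionality => t.
    by have := congr1 (@^~ t) h; rewrite /vadd => /addnI.
apply: fg_ext (fg_comb s (fg_reindex inl Wfg)) => x; split.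
  case=> _ [z Wz ->] ->; split; first by apply/sP; exists (z \o inl).
  by rewrite Wz; apply/sP'; exists (z \o inr).
case=> /sP [l xl] /sP' [l' xl'].
exists l => //; exists (fun u => match u with inl i => l i | inr j => l' j end) => //.
by rewrite /W -[comb s _]xl -[comb s' _]xl'.
Qed.

(** The triples [(x, k, l)] with [x + k mu = comb s l] form a solution monoid, and the projection to
    [x] keeps it finitely generated. *)
Lemma fg_colon (T : finType) (M : (T -> nat) -> Prop) (mu : T -> nat) :
  fg M -> fg (fun x => exists k, M (fun t => (x t + k * mu t)%N)).
Proof.
move=> [G [s sP]].
pose W (z : T + (unit + 'I_G) -> nat) := forall t,
  (z (inl t) + z (inr (inl tt)) * mu t)%N = comb s (fun j => z (inr (inr j))) t.
have WD x y : comb s (fun j => vadd x y (inr (inr j))) =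
    vadd (comb s (fun j => (x : T + (unit + 'I_G) -> nat) (inr (inr j))))
         (comb s (fun j => y (inr (inr j)))).
  exact: comb_add.
have Wfg : fg W.
  apply: fg_full; rewrite /W.
  - by move=> t; rewrite [RHS](congr1 (@^~ t) (comb_zero s)).
  - move=> x y hx hy t; rewrite WD /vadd -hx -hy; nia.
  - move=> x y hx hxy t; move: (hx t) (hxy t); rewrite WD /vadd; nia.
apply: fg_ext (fg_reindex inl Wfg) => x; split.
  case=> z Wz ->; exists (z (inr (inl tt))); apply/sP.
  exists (fun j => z (inr (inr j))).
  by apply: functional_extensionality => t; rewrite -Wz.
case=> k /sP [l lE].
exists (fun u => match u with inl t => x t | inr (inl _) => k
                 | inr (inr j) => l j end) => // t.
by rewrite -[comb s _ t](congr1 (@^~ t) lE).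
Qed.

Lemma fg_bigcap (T : finType) k (M : 'I_k -> (T -> nat) -> Prop) :
  (forall i, fg (M i)) -> fg (fun x => forall i, M i x).
Proof.
elim: k M => [|k IH] M fM.
  by apply: fg_full => // [[]|x y _ _ []|x y _ _ []].
apply: fg_ext (fg_inter (fM ord0) (IH _ (fun i => fM (lift ord0 i)))) => x.
split=> [[h0 h] i|h]; last by split.
by case: (unliftP ord0 i) => [j|] ->.
Qed.

(** Noetherian property of finitely generated monoids: Dickson's lemma is applied to the coefficient
    vectors whose combination lies in [E], and the combination of a difference of such vectors lies
    in [M]. *)
Lemma fg_ideal (T : Type) (M E : (T -> nat) -> Prop) :
  fg M -> (forall x, E x -> M x) -> (forall x y, E x -> M y -> E (vadd x y)) ->
  exists (k : nat) (e : 'I_k -> T -> nat), (forall i, E (e i)) /\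
    forall x, E x -> exists i y, M y /\ x = vadd (e i) y.
Proof.
move=> [G [s sP]] EM ED.
have [k [v [vU vP]]] := dickson (fun l => E (comb s l)).
exists k, (fun i => comb s (v i)); split=> // x Ex.
have [l xl] := (sP x).1 (EM x Ex).
rewrite xl in Ex *; have [i vi] := vP l Ex.
have lE := vadd_subK vi; set l' := (fun t => _) in lE.
exists i, (comb s l'); split; first by apply/sP; exists l'.
by rewrite {1}lE comb_add.
Qed.

Lemma fg_zero (T : Type) (M : (T -> nat) -> Prop) : fg M -> M (@vzero T).
Proof. by case=> G [s sP]; apply/sP; exists (@vzero _); rewrite comb_zero. Qed.

Lemma fg_add (T : Type) (M : (T -> nat) -> Prop) x y :
  fg M -> M x -> M y -> M (vadd x y).
Proof.
case=> G [s sP] /sP [l ->] /sP [l' ->]; apply/sP.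
by exists (vadd l l'); rewrite comb_add.
Qed.

(** * Presburger functions *)

Definition upd (T : Type) (v : nat -> T) (i : nat) (z : T) : nat -> T :=
  fun j => if j == i then z else v j.

(** A predicate on functions rather than a syntax of terms, so that equality is pointwise. Variables
    are indexed by all of [nat], which leaves room for auxiliary summation variables. *)
Inductive aff : ((nat -> int) -> int) -> Prop :=
| aff_const c : aff (fun=> c)
| aff_var i : aff (fun v => v i)
| aff_add f g : aff f -> aff g -> aff (fun v => f v + g v)
| aff_scale c f : aff f -> aff (fun v => c * f v).

Lemma aff_ext f g : (forall v, f v = g v) -> aff f -> aff g.
Proof. by move=> /functional_extensionality ->. Qed.

Lemma updK (T : Type) (v : nat -> T) i z z' : upd (upd v i z) i z' = upd v i z'.
Proof.
by apply: functional_extensionality => j; rewrite /upd; case: eqP.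
Qed.

Lemma updE (T : Type) (v : nat -> T) i z : upd v i z i = z.
Proof. by rewrite /upd eqxx. Qed.

Lemma updN (T : Type) (v : nat -> T) i j z : j != i -> upd v i z j = v j.
Proof. by rewrite /upd => /negbTE ->. Qed.

Lemma aff_split f i : aff f ->
  exists a f0, [/\ aff f0, (forall v z, f0 (upd v i z) = f0 v) &
                   forall v, f v = a * v i + f0 v].
Proof.
elim=> [c|j|{}f g _ [a [f0 [af fi fE]]] _ [b [g0 [ag gi gE]]]
       |c {}f _ [a [f0 [af fi fE]]]].
- by exists 0, (fun=> c); split=> // [|v]; [exact: aff_const | rewrite mul0r add0r].
- have [->|ji] := eqVneq j i.
    by exists 1, (fun=> 0); split=> // [|v]; [exact: aff_const | rewrite mul1r addr0].
  exists 0, (fun v => v j); split=> [|v z|v]; first exact: aff_var.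
    by rewrite updN.
  by rewrite mul0r add0r.
- exists (a + b), (fun v => f0 v + g0 v); split=> [|v z|v]; first exact: aff_add.
    by rewrite fi gi.
  rewrite fE gE; ring.
- exists (c * a), (fun v => c * f0 v); split=> [|v z|v]; first exact: aff_scale.
    by rewrite fi.
  rewrite fE; ring.
Qed.

Lemma aff_subst f l i : aff f -> aff l -> aff (fun v => f (upd v i (l v))).
Proof.
move=> af al; elim: af => [c|j|{}f g _ IHf _ IHg|c {}f _ IHf].
- exact: aff_const.
- rewrite /upd; case: (j == i) => //; exact: aff_var.
- exact: aff_add.
- exact: aff_scale.
Qed.

(** The substituted value [z] is a quotient of [l v] by [a] and need not be affine in [v];
    multiplying by [a] clears the denominator. *)
Lemma aff_divsubst f l i (a : int) : aff f -> aff l ->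
  exists f', aff f' /\ forall v z, a * z = l v -> a * f (upd v i z) = f' v.
Proof.
move=> af al; elim: af => [c|j|{}f g _ [f' [af' fE]] _ [g' [ag' gE]]
    |c {}f _ [f' [af' fE]]].
- by exists (fun=> a * c); split=> //; exact: aff_const.
- rewrite /upd; have [ji|ji] := eqVneq j i; first by exists l.
  exists (fun v => a * v j); split=> //; exact/aff_scale/aff_var.
- exists (fun v => f' v + g' v); split; first exact: aff_add.
  by move=> v z h; rewrite mulrDr (fE v z h) (gE v z h).
- exists (fun v => c * f' v); split; first exact: aff_scale.
  by move=> v z h; rewrite mulrCA (fE v z h).
Qed.

(** Products are not a constructor but are derived in [pfun_mul], which keeps inductions over [pfun]
    free of a product case. Moduli are written [m.+1] to be positive. *)
Inductive pfun : ((nat -> int) -> rat) -> Prop :=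
| pfun_const c : pfun (fun=> c)
| pfun_add f g : pfun f -> pfun g -> pfun (fun v => f v + g v)
| pfun_var i f : pfun f -> pfun (fun v => (v i)%:~R * f v)
| pfun_ge l f : aff l -> pfun f -> pfun (fun v => if 0 <= l v then f v else 0)
| pfun_mod (m : nat) l f : aff l -> pfun f ->
    pfun (fun v => if (m.+1 %| l v)%Z then f v else 0).

Lemma pfun_ext f g : (forall v, f v = g v) -> pfun f -> pfun g.
Proof. by move=> /functional_extensionality ->. Qed.

Lemma pfun_mul f g : pfun f -> pfun g -> pfun (fun v => f v * g v).
Proof.
move=> pf pg; elim: pf => [c|f1 f2 _ IH1 _ IH2|i {}f _ IH|l {}f al _ IH
    |m l {}f al _ IH].
- elim: pg => [c'|f1 f2 _ IH1 _ IH2|i {}f _ IH|l {}f al _ IH|m l {}f al _ IH].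
  + exact: pfun_const.
  + by apply: pfun_ext (pfun_add IH1 IH2) => v; rewrite mulrDr.
  + by apply: pfun_ext (pfun_var i IH) => v; rewrite mulrCA.
  + by apply: pfun_ext (pfun_ge al IH) => v; case: ifP; rewrite ?mulr0.
  + by apply: pfun_ext (pfun_mod m al IH) => v; case: ifP; rewrite ?mulr0.
- by apply: pfun_ext (pfun_add IH1 IH2) => v; rewrite mulrDl.
- by apply: pfun_ext (pfun_var i IH) => v; rewrite mulrA.
- by apply: pfun_ext (pfun_ge al IH) => v; case: ifP; rewrite ?mul0r.
- by apply: pfun_ext (pfun_mod m al IH) => v; case: ifP; rewrite ?mul0r.
Qed.

Lemma pfun_scale c f : pfun f -> pfun (fun v => c * f v).
Proof. exact/pfun_mul/pfun_const. Qed.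

Lemma pfun_sub f g : pfun f -> pfun g -> pfun (fun v => f v - g v).
Proof.
move=> pf pg; apply: pfun_ext (pfun_add pf (pfun_scale (-1) pg)) => v.
by rewrite mulN1r.
Qed.

Lemma pfun_sum (I : Type) (s : seq I) (F : I -> (nat -> int) -> rat) :
  (forall i, pfun (F i)) -> pfun (fun v => \sum_(i <- s) F i v).
Proof.
move=> pF; elim: s => [|a s IH].
  by apply: pfun_ext (pfun_const 0) => v; rewrite big_nil.
by apply: pfun_ext (pfun_add (pF a) IH) => v; rewrite big_cons.
Qed.

Lemma pfun_aff l : aff l -> pfun (fun v => (l v)%:~R).
Proof.
elim=> [c|i|f g _ IHf _ IHg|c f _ IH].
- exact: pfun_const.
- by apply: pfun_ext (pfun_var i (pfun_const 1)) => v; rewrite mulr1.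
- by apply: pfun_ext (pfun_add IHf IHg) => v; rewrite intrD.
- by apply: pfun_ext (pfun_scale c%:~R IH) => v; rewrite intrM.
Qed.

Lemma pfun_horner (q : {poly rat}) i : pfun (fun v => q.[(v i)%:~R]).
Proof.
elim/poly_ind: q => [|q c IH].
  by apply: pfun_ext (pfun_const 0) => v; rewrite horner0.
apply: pfun_ext (pfun_add (pfun_var i IH) (pfun_const c)) => v.
by rewrite !hornerE mulrC.
Qed.

(** Divisibility makes the quotient exact. A factor [v i] turns into [l v] divided by [a.+1], an
    inequality is multiplied by [a.+1], and in a congruence the modulus is multiplied as well. *)
Lemma pfun_divsubst_dvd f l i (a : nat) : pfun f -> aff l ->
  pfun (fun v => if (a.+1 %| l v)%Z then f (upd v i (l v %/ a.+1)%Z) else 0).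
Proof.
move=> pf al; have a0 : (a.+1 : int) != 0 by [].
have dE v : (a.+1 %| l v)%Z -> (a.+1 : int) * (l v %/ a.+1)%Z = l v.
  by move=> /divzK; rewrite mulrC.
elim: pf => [c|f1 f2 _ IH1 _ IH2|j {}f _ IH|l0 {}f al0 _ IH|m l0 {}f al0 _ IH].
- exact: pfun_mod al (pfun_const c).
- apply: pfun_ext (pfun_add IH1 IH2) => v; case: ifP => // _; exact: addr0.
- have [ji|ji] := eqVneq j i.
    apply: pfun_ext (pfun_mul (pfun_scale (a.+1%:~R)^-1 (pfun_aff al)) IH) => v.
    case: ifP => [/dE lE|]; last by rewrite mulr0.
    rewrite ji updE -{1}lE intrM mulKf //; by rewrite intr_eq0.
  apply: pfun_ext (pfun_var j IH) => v.
  by case: ifP => _; rewrite ?mulr0 // updN.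
- have [l' [al' lE]] := aff_divsubst i (a.+1 : int) al0 al.
  apply: pfun_ext (pfun_ge al' IH) => v.
  case: (boolP (a.+1 %| l v)%Z) => [/dE /lE <-|_]; last by case: ifP.
  by rewrite pmulr_rge0.
- have [l' [al' lE]] := aff_divsubst i (a.+1 : int) al0 al.
  apply: pfun_ext (pfun_mod (a.+1 * m.+1).-1 al' IH) => v.
  case: (boolP (a.+1 %| l v)%Z) => [/dE /lE <-|_]; last by case: ifP.
  by rewrite prednK // PoszM dvdz_mul2l.
Qed.

(** The sum runs over all candidate residues [c] of [l v]. Only the true residue passes the
    divisibility test, and there [l v - c] has the same quotient as [l v]. *)
Lemma pfun_divsubst f l i (a : nat) : pfun f -> aff l ->
  pfun (fun v => f (upd v i (l v %/ a.+1)%Z)).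
Proof.
move=> pf al.
have al' (c : 'I_a.+1) : aff (fun v => l v + - (c : nat)%:Z).
  exact: aff_add al (aff_const _).
apply: pfun_ext (pfun_sum (index_enum _)
  (fun c : 'I_a.+1 => pfun_divsubst_dvd i a pf (al' c))) => v.
pose r := absz (l v %% a.+1)%Z.
have rE : (l v %% a.+1)%Z = r by rewrite /r gez0_abs // modz_ge0.
have rlt : (r < a.+1)%N by rewrite -ltz_nat -rE ltz_pmod.
have lE := divz_eq (l v) a.+1; rewrite rE in lE.
rewrite (bigD1 (Ordinal rlt)) //= big1 => [|c /eqP cr].
  rewrite addr0 {1 2}lE addrK dvdz_mull // mulzK //.
case: ifP => // /dvdzP[k kE]; case: cr; apply: val_inj => /=.
have := ltn_ord c; rewrite ltnS => hc.
have : l v = k * a.+1 + (c : nat)%:Z by rewrite -kE subrK.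
rewrite lE => e.
have : (r%:Z %% a.+1)%Z = ((c : nat)%:Z %% a.+1)%Z.
  by have := congr1 (fun z => (z %% a.+1)%Z) e; rewrite !modzMDl.
by rewrite !modz_small ?ltz_nat //; case.
Qed.

Lemma pfun_subst f l i : pfun f -> aff l -> pfun (fun v => f (upd v i (l v))).
Proof.
move=> pf al; apply: pfun_ext (pfun_divsubst i 0 pf al) => v.
by rewrite divz1.
Qed.

(** * Summation of Presburger functions over intervals *)

Lemma sum_ge_split (h : nat -> rat) (N L : nat) : (L <= N)%N ->
  \sum_(y < N) (if (L <= y)%N then h y else 0) =
  \sum_(y < N) h y - \sum_(y < L) h y.
Proof.
move=> LN; rewrite -(subnKC LN) !big_split_ord /= [RHS]addrAC subrr add0r.
rewrite big1 => [|y _]; last by rewrite leqNgt ltn_ord.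
by rewrite add0r; apply: eq_bigr => y _; rewrite leq_addr.
Qed.

(** Each [y] is written as [M.+1 * z + c]; the inner bound counts the numbers below [N] with residue
    [c]. When [N] grows by one, exactly the count for the residue of [N] grows, which is [cnt]. *)
Lemma sum_residues (h : nat -> rat) (M N : nat) :
  \sum_(y < N) h y =
  \sum_(c < M.+1) \sum_(z < (N + M - c) %/ M.+1) h (M.+1 * z + c)%N.
Proof.
have cnt n c : (c < M.+1)%N ->
    ((n.+1 + M - c) %/ M.+1)%N = ((n + M - c) %/ M.+1 + (c == n %% M.+1)%N)%N.
  move=> cM; have bM := ltn_pmod n (ltn0Sn M).
  rewrite {1 2}(divn_eq n M.+1); set a := (n %/ _)%N; set b := (n %% _)%N in bM *.
  have -> : ((a * M.+1 + b).+1 + M - c)%N = (a * M.+1 + (b + M.+1 - c))%N by lia.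
  have -> : ((a * M.+1 + b) + M - c)%N = (a * M.+1 + (b + M - c))%N by lia.
  rewrite !divnMDl // -addnA; congr (_ + _)%N.
  case: (ltngtP c b) => cb.
  - have -> : (b + M.+1 - c = 1 * M.+1 + (b - c))%N by lia.
    have -> : (b + M - c = 1 * M.+1 + (b - c - 1))%N by lia.
    rewrite !divnMDl // !divn_small //; lia.
  - rewrite !divn_small //; lia.
  - have -> : (b + M.+1 - c = 1 * M.+1 + 0)%N by lia.
    rewrite divnMDl // (@divn_small (b + M - c)) //; lia.
elim: N => [|N IH].
  rewrite big_ord0 big1 // => c _; rewrite divn_small ?big_ord0 //; lia.
rewrite big_ord_recr IH /=.
have bM : (N %% M.+1 < M.+1)%N by rewrite ltn_pmod.
rewrite (bigD1 (Ordinal bM)) //= [RHS](bigD1 (Ordinal bM)) //=.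
rewrite (cnt N (N %% M.+1)%N) // eqxx addn1 big_ord_recr /=.
have NE : ((N + M - N %% M.+1) %/ M.+1)%N = (N %/ M.+1)%N.
  rewrite {1}(divn_eq N M.+1).
  have -> : ((N %/ M.+1) * M.+1 + N %% M.+1 + M - N %% M.+1)%N
    = ((N %/ M.+1) * M.+1 + M)%N by lia.
  by rewrite divnMDl // (divn_small (ltnSn M)) addn0.
rewrite NE [(M.+1 * _)%N]mulnC -divn_eq addrAC -!addrA; congr (_ + _).
congr (_ + _).
apply: eq_bigr => c /eqP cN; rewrite cnt //.
have -> : (c == N %% M.+1 :> nat)%N = false.
  by apply/eqP => cE; apply: cN; apply: val_inj.
by rewrite /= addn0.
Qed.

(** With [p] the degree of [q], the forward difference [D] of [X^(p+1)] has leading term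
    [(p+1) X^p]. A multiple of it cancels the leading term of [q] and telescopes when summed; the
    rest has smaller size. *)
Lemma poly_antidiff (q : {poly rat}) : exists Q : {poly rat},
  forall N : nat, Q.[N%:R] = \sum_(y < N) q.[y%:R].
Proof.
have [n] := ubnP (size q); elim: n q => // n IH q.
case: (posnP (size q)) => [/eqP|q0 qn].
  rewrite size_poly_eq0 => /eqP -> _; exists 0 => N.
  by rewrite horner0 big1 // => y _; rewrite horner0.
pose p := (size q).-1; pose c := lead_coef q / (p.+1)%:R.
have p0 : (p.+1)%:R != 0 :> rat by rewrite pnatr_eq0.
pose D := ('X + 1) ^+ p.+1 - 'X^(p.+1) : {poly rat}.
have DE : D = \sum_(i < p.+1) 'X^i *+ 'C(p.+1, i).
  rewrite /D (addrC 'X 1) exprDn big_ord_recr /= binn mulr1n expr1n mul1r addrK.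
  by apply: eq_bigr => i _; rewrite expr1n mul1r.
have qD : (size (q - c *: D)%R < size q)%N.
  have pq : p.+1 = size q by rewrite prednK.
  rewrite -pq ltnS; apply/leq_sizeP => j; rewrite leq_eqVlt => /orP[/eqP <-|pj].
    rewrite coefB coefZ DE coef_sum big_ord_recr /= big1 => [|i _].
      rewrite coefMn coefXn eqxx add0r binSn /c /lead_coef -/p.
      by rewrite divfK // subrr.
    by rewrite coefMn coefXn gtn_eqF // mul0rn.
  rewrite coefB coefZ DE coef_sum big1 => [|i _].
    by rewrite mulr0 subr0 nth_default // -pq.
  rewrite coefMn coefXn gtn_eqF ?mul0rn //; exact: leq_trans (ltn_ord i) pj.
have [Q QE] := IH _ (leq_trans qD qn).
exists (Q + c *: 'X^(p.+1)) => N; rewrite hornerD QE hornerZ hornerXn.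
have -> : c * N%:R ^+ p.+1 = \sum_(y < N) (c *: D).[y%:R].
  elim: N => [|N IHN]; first by rewrite big_ord0 expr0n mulr0.
  rewrite big_ord_recr /= -IHN hornerZ /D !hornerE natr1; ring.
rewrite -big_split; apply: eq_bigr => y _ /=.
by rewrite -hornerD subrK.
Qed.

(** The weight [q] and the progression [m.+1 * y + c] strengthen the claim for induction: the weight
    absorbs factors of the summation variable, the progression absorbs congruences. The upper limit
    is passed to [G] in slot [i]. *)
Definition summable (i : nat) (f : (nat -> int) -> rat) : Prop :=
  forall (q : {poly rat}) (m : nat) (c : int), exists G, pfun G /\
    forall v (N : nat), G (upd v i N%:Z) =
      \sum_(y < N) q.[y%:R] * f (upd v i (m.+1%:Z * (y : nat)%:Z + c)).

(** The condition says that [y] is at least a threshold, so the sum is [G] at [N] minus [G] at the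
    threshold. The outer test gives zero when the threshold exceeds [N], the inner one drops the
    subtraction when it is negative. *)
Lemma sum_ge_pfun i (b : nat) l1 (h : (nat -> int) -> nat -> rat) G :
  aff l1 -> (forall v z, l1 (upd v i z) = l1 v) ->
  pfun G -> (forall v (N : nat), G (upd v i N%:Z) = \sum_(y < N) h v y) ->
  exists G', pfun G' /\ forall v (N : nat), G' (upd v i N%:Z) =
    \sum_(y < N) if 0 <= b.+1%:Z * (y : nat)%:Z + l1 v then h v y else 0.
Proof.
move=> al li pG GE.
(* [num v %/ b.+1] is the ceiling of [- l1 v / b.+1], the least [y] satisfying the condition. *)
pose num v := - l1 v + b%:Z.
have anum : aff num.
  apply: aff_ext (aff_add (aff_scale (-1) al) (aff_const b%:Z)) => v.
  by rewrite /num mulN1r.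
have abl : aff (fun v => b.+1%:Z * v i + l1 v).
  exact: aff_add (aff_scale _ (aff_var i)) al.
exists (fun v => if 0 <= b.+1%:Z * v i + l1 v then G v -
    (if 0 <= num v then G (upd v i (num v %/ b.+1)%Z) else 0) else 0); split.
  exact: pfun_ge abl (pfun_sub pG (pfun_ge anum (pfun_divsubst i b pG anum))).
move=> v N; rewrite updE updK /num !li -/(num v).
have Lle (y : nat) : (0 <= b.+1%:Z * y%:Z + l1 v) = ((num v %/ b.+1)%Z <= y%:Z).
  have numE := divz_eq (num v) b.+1.
  have r0 : 0 <= (num v %% b.+1)%Z by rewrite modz_ge0.
  have r1 : (num v %% b.+1)%Z < b.+1%:Z by rewrite ltz_pmod.
  rewrite /num in numE r0 r1 *.
  set k := (_ %/ _)%Z in numE *; set r := (_ %% _)%Z in numE r0 r1.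
  by apply/idP/idP; nia.
rewrite Lle; case: (boolP (0 <= num v)) => n0.
  have : 0 <= (num v %/ b.+1)%Z by rewrite divz_ge0.
  case E: (num v %/ b.+1)%Z => [L|] // _; rewrite lez_nat.
  rewrite !GE; case: (leqP L N) => LN.
    rewrite -sum_ge_split //; apply: eq_bigr => y _.
    by rewrite Lle E lez_nat.
  rewrite big1 // => y _; rewrite Lle E lez_nat leqNgt (ltn_trans (ltn_ord y)) //.
have Lneg : (num v %/ b.+1)%Z < 0 by rewrite ltNge divz_ge0.
rewrite subr0 (le_trans (ltW Lneg)) // GE; apply: eq_bigr => y _.
by rewrite Lle (le_trans (ltW Lneg)).
Qed.

(** Constants are summed by [poly_antidiff], inequalities cut the interval at an affine threshold,
    and congruences split it into residue classes. *)
Lemma pfun_summable i f : pfun f -> summable i f.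
Proof.
elim=> [c0|f1 f2 _ IH1 _ IH2|j {}f _ IH|l {}f al _ IH|m' l {}f al _ IH] q m c.
- have [Q QE] := poly_antidiff q.
  exists (fun v => Q.[(v i)%:~R] * c0); split.
    exact: pfun_mul (pfun_horner Q i) (pfun_const c0).
  by move=> v N; rewrite updE QE mulr_suml.
- have [G1 [p1 E1]] := IH1 q m c; have [G2 [p2 E2]] := IH2 q m c.
  exists (fun v => G1 v + G2 v); split; first exact: pfun_add.
  move=> v N; rewrite E1 E2 -big_split; apply: eq_bigr => y _.
  by rewrite /= mulrDr.
- have [ji|ji] := eqVneq j i.
    (* The factor is the summation variable itself, so it is moved into the polynomial weight. *)
    have [G [pG GE]] := IH (q * (m.+1%:R *: 'X + c%:~R%:P)) m c.
    exists G; split=> // v N; rewrite GE; apply: eq_bigr => y _.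
    by rewrite ji updE hornerM !hornerE intrD intrM.
  have [G [pG GE]] := IH q m c.
  exists (fun v => (v j)%:~R * G v); split; first exact: pfun_var.
  move=> v N; rewrite GE updN // mulr_sumr.
  by apply: eq_bigr => y _; rewrite updN // mulrCA.
- have [G [pG GE]] := IH q m c.
  have [a [l0 [al0 l0i lE]]] := aff_split i al.
  pose l1 v := a * c + l0 v.
  have al1 : aff l1 by apply: aff_add (aff_const _) al0.
  have l1i v z : l1 (upd v i z) = l1 v by rewrite /l1 l0i.
  pose h v y := q.[y%:R] * f (upd v i (m.+1%:Z * y%:Z + c)).
  have lE' v (y : nat) :
      l (upd v i (m.+1%:Z * y%:Z + c)) = a * m.+1%:Z * y%:Z + l1 v.
    rewrite lE updE l0i /l1; ring.
  have tE v (y : nat) : q.[y%:R] * (if 0 <= l (upd v i (m.+1%:Z * y%:Z + c))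
      then f (upd v i (m.+1%:Z * y%:Z + c)) else 0) =
      if 0 <= a * m.+1%:Z * y%:Z + l1 v then h v y else 0.
    by rewrite lE'; case: ifP => _; rewrite ?mulr0.
  have [a0|a0|a0] := ltrgtP a 0; last 1 first.
  + exists (fun v => if 0 <= l1 v then G v else 0); split; first exact: pfun_ge.
    move=> v N; rewrite l1i GE.
    rewrite [RHS](eq_bigr (fun y : 'I_N => if 0 <= l1 v then h v y else 0)).
      by case: (0 <= l1 v); last by rewrite big1.
    by move=> y _; rewrite tE a0 !mul0r add0r.
  (* For negative slope the complementary condition has positive slope, and its sum is subtracted
     from the full sum. *)
  + have [b bE] : exists b : nat, a * m.+1%:Z = - b.+1%:Z.
      have : a * m.+1%:Z < 0 by rewrite nmulr_rlt0.
      by case: (a * m.+1%:Z) => [|b] // _; exists b.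
    have al2 : aff (fun v => - l1 v - 1).
      apply: aff_ext (aff_add (aff_scale (-1) al1) (aff_const (-1))) => v.
      by rewrite mulN1r.
    have l2i v z : (fun v => - l1 v - 1) (upd v i z) = - l1 v - 1 by rewrite /= l1i.
    have [G' [pG' GE']] := sum_ge_pfun (h := h) b al2 l2i pG GE.
    exists (fun v => G v - G' v); split; first exact: pfun_sub.
    move=> v N; rewrite GE GE' -sumrB; apply: eq_bigr => y _.
    rewrite tE bE -/(h v y).
    have -> : (0 <= - b.+1%:Z * (y : nat)%:Z + l1 v) =
        ~~ (0 <= b.+1%:Z * (y : nat)%:Z + (- l1 v - 1)).
      by apply/idP/idP; lia.
    by case: ifP => _; rewrite ?subrr ?subr0.
  + have [b bE] : exists b : nat, a * m.+1%:Z = b.+1%:Z.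
      have : 0 < a * m.+1%:Z by rewrite mulr_gt0.
      by case: (a * m.+1%:Z) => [[|b]|] // _; exists b.
    have [G' [pG' GE']] := sum_ge_pfun (h := h) b al1 l1i pG GE.
    exists G'; split=> // v N; rewrite GE'; apply: eq_bigr => y _.
    by rewrite tE bE.
(* For [y = m'.+1 * z + c'] the congruence depends on [c'] only, and [f] is summed over [z] along a
   progression of step [m.+1 * m'.+1] with the weight composed accordingly. *)
- pose g (c' : 'I_m'.+1) := q \Po (m'.+1%:R *: 'X + (c' : nat)%:R%:P).
  have := fun c' : 'I_m'.+1 =>
    IH (g c') (m.+1 * m'.+1).-1 (m.+1%:Z * (c' : nat)%:Z + c).
  case/fin_all_exists => G HG.
  have pG c' := (HG c').1; have GE c' := (HG c').2.
  have aK (c' : 'I_m'.+1) : aff (fun v => v i + (m'%:Z - (c' : nat)%:Z)).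
    exact: aff_add (aff_var i) (aff_const _).
  have alc (c' : 'I_m'.+1) : aff (fun v => l (upd v i (m.+1%:Z * (c' : nat)%:Z + c))).
    exact: aff_subst al (aff_const _).
  exists (fun v => \sum_(c' < m'.+1)
    if (m'.+1 %| l (upd v i (m.+1%:Z * (c' : nat)%:Z + c)))%Z then
      G c' (upd v i ((v i + (m'%:Z - (c' : nat)%:Z)) %/ m'.+1)%Z) else 0).
  split.
    apply: pfun_sum => c'.
    exact: pfun_mod (alc c') (pfun_divsubst i m' (pG c') (aK c')).
  move=> v N.
  rewrite (sum_residues (fun y => q.[y%:R] *
    (if (m'.+1 %| l (upd v i (m.+1%:Z * y%:Z + c)))%Z
     then f (upd v i (m.+1%:Z * y%:Z + c)) else 0)) m').
  apply: eq_bigr => c' _; rewrite updE !updK.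
  have c'm := ltn_ord c'.
  have -> : N%:Z + (m'%:Z - (c' : nat)%:Z) = (N + m' - c')%N%:Z by lia.
  rewrite divz_nat GE.
  have [a [l0 [al0 l0i lE]]] := aff_split i al.
  have dvdE (z : nat) :
      (m'.+1 %| l (upd v i (m.+1%:Z * (m'.+1 * z + c')%N%:Z + c)))%Z =
      (m'.+1 %| l (upd v i (m.+1%:Z * (c' : nat)%:Z + c)))%Z.
    rewrite !lE !updE !l0i.
    have -> : a * (m.+1%:Z * (m'.+1 * z + c')%N%:Z + c) + l0 v =
      (a * m.+1%:Z * z%:Z) * m'.+1%:Z + (a * (m.+1%:Z * (c' : nat)%:Z + c) + l0 v).
      rewrite PoszD PoszM; ring.
    by rewrite rpredDl // dvdz_mull.
  under [RHS]eq_bigr => z _ do rewrite dvdE.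
  case: ifP => _; last by rewrite big1 // => z _; rewrite mulr0.
  apply: eq_bigr => z _; congr (_ * f _).
    by rewrite /g horner_comp !hornerE natrD natrM.
  congr (upd v i _); rewrite prednK // PoszD !PoszM; ring.
Qed.

Lemma pfun_bigsum i f l : pfun f -> aff l -> exists G, pfun G /\
  forall v (N : nat), l v = N%:Z -> G v = \sum_(y < N) f (upd v i (y : nat)%:Z).
Proof.
move=> pf al; have [G [pG GE]] := @pfun_summable i f pf 1 0 0.
exists (fun v => G (upd v i (l v))); split; first exact: pfun_subst.
move=> v N ->; rewrite GE; apply: eq_bigr => y _.
by rewrite hornerC mul1r mul1r addr0.
Qed.

(** * Presburger functions and predicates of natural numbers *)

Definition asb (P : Prop) : bool :=
  if excluded_middle_informative P then true else false.

Lemma asbP (P : Prop) : reflect P (asb P).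
Proof. by rewrite /asb; case: excluded_middle_informative => h; constructor. Qed.

Definition zenv (v : nat -> nat) : nat -> int := fun i => (v i)%:Z.

Definition nfun (f : (nat -> nat) -> rat) : Prop :=
  exists g, pfun g /\ forall v, f v = g (zenv v).

Definition naff (l : (nat -> nat) -> int) : Prop :=
  exists g, aff g /\ forall v, l v = g (zenv v).

Lemma zenv_upd v i y : zenv (upd v i y) = upd (zenv v) i y%:Z.
Proof.
by apply: functional_extensionality => j; rewrite /zenv /upd; case: eqP.
Qed.

Lemma naff_const c : naff (fun=> c).
Proof. by exists (fun=> c); split=> //; exact: aff_const. Qed.

Lemma naff_var i : naff (fun v => (v i)%:Z).
Proof. by exists (fun v => v i); split=> //; exact: aff_var. Qed.

Lemma naff_add f g : naff f -> naff g -> naff (fun v => f v + g v).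
Proof.
move=> [f' [af fE]] [g' [ag gE]]; exists (fun v => f' v + g' v).
by split=> [|v]; [exact: aff_add | rewrite fE gE].
Qed.

Lemma naff_scale c f : naff f -> naff (fun v => c * f v).
Proof.
move=> [f' [af fE]]; exists (fun v => c * f' v).
by split=> [|v]; [exact: aff_scale | rewrite fE].
Qed.

Lemma naff_ext f g : (forall v, f v = g v) -> naff f -> naff g.
Proof. by move=> /functional_extensionality ->. Qed.

Lemma naff_sum (I : Type) (s : seq I) (F : I -> (nat -> nat) -> int) :
  (forall i, naff (F i)) -> naff (fun v => \sum_(i <- s) F i v).
Proof.
move=> aF; elim: s => [|a s IH].
  by apply: naff_ext (naff_const 0) => v; rewrite big_nil.
by apply: naff_ext (naff_add (aF a) IH) => v; rewrite big_cons.
Qed.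

Lemma nfun_ext f g : (forall v, f v = g v) -> nfun f -> nfun g.
Proof. by move=> /functional_extensionality ->. Qed.

Lemma nfun_const c : nfun (fun=> c).
Proof. by exists (fun=> c); split=> //; exact: pfun_const. Qed.

Lemma nfun_mul f g : nfun f -> nfun g -> nfun (fun v => f v * g v).
Proof.
move=> [f' [af fE]] [g' [ag gE]]; exists (fun v => f' v * g' v).
by split=> [|v]; [exact: pfun_mul | rewrite fE gE].
Qed.

Lemma nfun_sub f g : nfun f -> nfun g -> nfun (fun v => f v - g v).
Proof.
move=> [f' [af fE]] [g' [ag gE]]; exists (fun v => f' v - g' v).
by split=> [|v]; [exact: pfun_sub | rewrite fE gE].
Qed.

Lemma nfun_bigsum i f (B : (nat -> nat) -> nat) :
  nfun f -> naff (fun v => (B v)%:Z) ->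
  nfun (fun v => \sum_(y < B v) f (upd v i y)).
Proof.
move=> [f' [pf fE]] [l [al lE]].
have [G [pG GE]] := pfun_bigsum i pf al.
exists G; split=> // v; rewrite (GE _ (B v)) ?lE //.
by apply: eq_bigr => y _; rewrite fE zenv_upd.
Qed.

Definition npred (P : (nat -> nat) -> bool) : Prop := nfun (fun v => (P v)%:R).

Lemma npred_and P Q : npred P -> npred Q -> npred (fun v => P v && Q v).
Proof.
move=> nP nQ; apply: nfun_ext (nfun_mul nP nQ) => v.
by rewrite -natrM mulnb.
Qed.

Lemma npred_not P : npred P -> npred (fun v => ~~ P v).
Proof.
move=> nP; apply: nfun_ext (nfun_sub (nfun_const 1) nP) => v.
by case: (P v); rewrite ?subrr ?subr0.
Qed.

Lemma npred_all (I : Type) (s : seq I) (P : I -> (nat -> nat) -> bool) :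
  (forall i, npred (P i)) -> npred (fun v => all (P^~ v) s).
Proof.
by move=> nP; elim: s => [|a s IH] /=; [exact: nfun_const | exact: npred_and].
Qed.

Lemma npred_le (f g : (nat -> nat) -> nat) :
  naff (fun v => (f v)%:Z) -> naff (fun v => (g v)%:Z) ->
  npred (fun v => (f v <= g v)%N).
Proof.
move=> nf ng; have [l [al lE]] := naff_add ng (naff_scale (-1) nf).
exists (fun v => if 0 <= l v then 1 else 0); split.
  exact: pfun_ge al (pfun_const 1).
move=> v; rewrite -lE mulN1r subr_ge0 lez_nat; by case: leqP.
Qed.

Lemma npred_eq (f g : (nat -> nat) -> nat) :
  naff (fun v => (f v)%:Z) -> naff (fun v => (g v)%:Z) ->
  npred (fun v => f v == g v).
Proof.
move=> nf ng; apply: nfun_ext (npred_and (npred_le nf ng) (npred_le ng nf)).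
by move=> v; rewrite -eqn_leq.
Qed.

(** * Summation over boxes *)

Fixpoint boxseq (g b : nat) : seq (seq nat) :=
  if g is g'.+1 then [seq y :: s | y <- iota 0 b, s <- boxseq g' b]
  else [:: [::]].

Lemma mem_boxseq g b s :
  (s \in boxseq g b) = (size s == g) && all (fun y => (y < b)%N) s.
Proof.
elim: g s => [|g IH] s /=; first by case: s => [|y s].
apply/allpairsP/idP => [[[y s'] /= [yb s'b ->]]|] /=.
  by rewrite eqSS; move: s'b yb; rewrite IH mem_iota => /andP[-> ->] /andP[_ ->].
case: s => //= y s /and3P[sg yb sb]; exists (y, s).
by rewrite mem_iota IH sb yb -eqSS sg.
Qed.

Lemma uniq_boxseq g b : uniq (boxseq g b).
Proof.
elim: g => //= g IH; apply: allpairs_uniq => //; first exact: iota_uniq.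
by move=> [y s] [y' s'] _ _ [-> ->].
Qed.

Lemma size_boxseq g b : size (boxseq g b) = (b ^ g)%N.
Proof. by elim: g => //= g IH; rewrite size_allpairs size_iota IH expnS. Qed.

Fixpoint updl (v : nat -> nat) (k : nat) (s : seq nat) : nat -> nat :=
  if s is y :: s' then updl (upd v k y) k.+1 s' else v.

Lemma updl_lt v k s i : (i < k)%N -> updl v k s i = v i.
Proof.
elim: s v k => //= y s IH v k ik; rewrite IH ?updN //; last exact: ltnW.
by rewrite ltn_eqF.
Qed.

Lemma updl_nth v k s i : (i < size s)%N -> updl v k s (k + i)%N = nth 0%N s i.
Proof.
elim: s v k i => //= y s IH v k [|i] ilt /=.
  by rewrite addn0 updl_lt // updE.
by rewrite addnS -addSn IH.
Qed.

(** Iterated interval summation. The summation variables are stored in positions [k], [k+1] and so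
    on, and the side length [B] must not depend on them. *)
Lemma nfun_box (B : (nat -> nat) -> nat) g k f :
  nfun f -> naff (fun v => (B v)%:Z) ->
  (forall v i y, (k <= i)%N -> B (upd v i y) = B v) ->
  nfun (fun v => \sum_(s <- boxseq g (B v)) f (updl v k s)).
Proof.
move=> nf nB; elim: g k => [|g IH] k Bk.
  by apply: nfun_ext nf => v; rewrite big_seq1.
have Bk' : forall v i y, (k.+1 <= i)%N -> B (upd v i y) = B v.
  by move=> v i y ki; apply: Bk; apply: ltnW.
apply: nfun_ext (nfun_bigsum k (IH k.+1 Bk') nB) => v /=.
have -> : iota 0 (B v) = index_iota 0 (B v) by rewrite /index_iota subn0.
rewrite big_allpairs_dep /= big_mkord.
by apply: eq_bigr => y _; rewrite Bk.
Qed.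

(** * The indicator function of a finitely generated monoid *)

Section Membership.
Variables (T : finType) (M : (T -> nat) -> Prop) (idx : T -> nat) (k : nat).
Hypothesis idxk : forall t, (idx t < k)%N.

(* Minimal representations with respect to the monomial order pick exactly
   one coefficient vector in each fibre of [comb s], and the vectors that are
   not minimal form an up-closed set, hence a finite union of orthants. *)
Lemma npred_fg : fg M -> npred (fun v => asb (M (fun t => v (idx t)))).
Proof.
move=> [G [s sP]].
pose mn (l : 'I_G -> nat) := [multinom l i | i < G].
have mnD l l' : mn (vadd l l') = (mn l + mn l')%MM.
  by apply/mnmP => i; rewrite mnmDE !mnmE.
have mn_inj l l' : mn l = mn l' -> l = l'.
  move=> h; apply: functional_extensionality => i.
  by have := congr1 (fun m : 'X_{1..G} => m i) h; rewrite !mnmE.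
pose U l := exists2 l', comb s l' = comb s l & (mn l' < mn l)%O.
have UD l l' : U l -> U (vadd l l').
  move=> [l0 e lt]; exists (vadd l0 l'); first by rewrite !comb_add e.
  by rewrite !mnD ltmc_add2l.
have [K [g [gU gP]]] := dickson U.
have exmin l : exists2 l', comb s l' = comb s l & ~ U l'.
  have [m] : exists m, m = mn l by exists (mn l).
  elim/(well_founded_ind (@ltom_wf G)): m l => m IH l mE.
  case: (classic (U l)) => [[l' e lt]|nU]; last by exists l.
  rewrite -mE in lt; have [l0 e0 nU] := IH _ lt l' erefl.
  by exists l0; rewrite // e0 e.
have min_uniq l l' : comb s l = comb s l' -> ~ U l -> ~ U l' -> l = l'.
  move=> e nU nU'; apply: mn_inj; case: (ltgtP (mn l) (mn l')) => // lt.
    by case: nU'; exists l.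
  by case: nU; exists l'.
(* A minimal vector gives coefficient zero to a zero generator, since lowering that coefficient
   would give a smaller representation. Hence every coefficient is at most the coordinate sum of the
   represented point. *)
have min_bound l i : ~ U l -> (l i <= \sum_t comb s l t)%N.
  move=> nU; case: (posnP (l i)) => [->//|li0].
  have [t st] : exists t, (0 < s i t)%N.
    apply: NNPP => h; apply: nU.
    have lE := @vadd_subK _ (fun j => (j == i : nat)) l.
    have {lE} : l = vadd (fun j => (j == i : nat)) (fun j => (l j - (j == i))%N).
      by apply: lE => j; case: eqP => [->|].
    set l' := (fun j => _ - _)%N => lE.
    exists l'.
      rewrite lE comb_add comb_delta; apply: functional_extensionality => t.
      rewrite /vadd; case: (posnP (s i t)) => [->//|sit].
      by case: h; exists t.
    have -> : mn l = (U_(i) + mn l')%MM.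
      rewrite {1}lE mnD; congr (_ + _)%MM.
      by apply/mnmP => j; rewrite !mnmE eq_sym.
    by apply: lt_mdeg_ltmc; rewrite mdegD mdeg1 add1n.
  rewrite (bigD1 t) //=; apply: leq_trans (leq_addr _ _).
  rewrite /comb (bigD1 i) //=; apply: leq_trans (leq_addr _ _).
  by rewrite leq_pmulr.
pose B v := (\sum_t v (idx t)).+1%N.
pose lam w : 'I_G -> nat := fun i => w (k + i)%N.
(* The candidate coefficients sit in positions from [k] on. The first condition says that they
   dominate none of the finitely many vectors [g j], so they are minimal; the second that they
   represent the point. *)
pose ind w := all (fun j : 'I_K => ~~ all (fun i => (g j i <= lam w i)%N) (enum 'I_G))
    (enum 'I_K) &&
  all (fun t => w (idx t) == comb s (lam w) t) (enum T).
have indP w : reflect (~ U (lam w) /\ (fun t => w (idx t)) = comb s (lam w)) (ind w).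
  apply: (iffP andP) => [[/allP h1 /allP h2]|[h1 h2]]; split.
  - move=> Ul; have [j gj] := gP _ Ul.
    by have /allP [] := h1 j (mem_enum _ _); move=> i _; apply: gj.
  - apply: functional_extensionality => t; apply/eqP; apply: h2.
    by rewrite mem_enum.
  - apply/allP => j _; apply/negP => /allP h; apply: h1.
    rewrite (@vadd_subK _ (g j) (lam w)); first exact: UD.
    by move=> i; apply: h; rewrite mem_enum.
  - by apply/allP => t _; rewrite -(congr1 (@^~ t) h2).
have nlam i : naff (fun w => (lam w i)%:Z) by exact: naff_var.
have nind : npred ind.
  apply: npred_and; [apply: npred_all => j | apply: npred_all => t].
    apply/npred_not/npred_all => i; apply: npred_le => //; exact: naff_const.
  apply: npred_eq; first exact: naff_var.
  apply: naff_ext (naff_sum (index_enum _)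
    (fun i => naff_scale (s i t)%:Z (nlam i))) => w.
  rewrite /comb (big_morph Posz PoszD (erefl _)).
  by apply: eq_bigr => i _; rewrite mulnC PoszM.
have nB : naff (fun v => (B v)%:Z).
  apply: naff_ext (naff_add (naff_const 1)
    (naff_sum (index_enum T) (fun t => naff_var (idx t)))) => v.
  by rewrite -(big_morph Posz PoszD (erefl _)).
have Bk v i y : (k <= i)%N -> B (upd v i y) = B v.
  move=> ki; rewrite /B; congr _.+1; apply: eq_bigr => t _; rewrite updN //.
  by rewrite ltn_eqF // (leq_trans (idxk t)).
apply: nfun_ext (nfun_box G nind nB Bk) => v.
pose x t := v (idx t).
have idxE sq : (fun t => updl v k sq (idx t)) = x.
  by apply: functional_extensionality => t; rewrite updl_lt.
(* Outside [M] no vector of the box satisfies [ind]; inside [M] exactly one does, the minimal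
   representation. So the sum over the box is the indicator. *)
case: asbP => [/sP [l0 xl0]|nM]; last first.
  rewrite big1 // => sq _; case: (indP _) => // -[_ h]; case: nM.
  by apply/sP; eexists; rewrite -[LHS](idxE sq) h.
have [l e nU] := exmin l0.
have xl : x = comb s l by rewrite e -xl0.
pose sq := [seq l i | i <- enum 'I_G].
have szsq : size sq = G by rewrite size_map size_enum_ord.
have lamE : lam (updl v k sq) = l.
  apply: functional_extensionality => i; rewrite /lam updl_nth ?szsq //.
  by rewrite (nth_map i) ?size_enum_ord // nth_ord_enum.
rewrite (bigD1_seq sq) ?uniq_boxseq //=; last first.
  rewrite mem_boxseq szsq eqxx; apply/allP => _ /mapP[i _ ->].
  by rewrite /B ltnS -[(\sum_t _)%N]/(\sum_t x t)%N xl; apply: min_bound.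
case: (indP _) => [_|[]]; last by rewrite lamE idxE xl.
rewrite big_seq_cond big1 ?addr0 // => sq' /andP[]; rewrite mem_boxseq.
move=> /andP[/eqP sz' _] /eqP ne; case: (indP _) => // -[nU' h]; case: ne.
have lE : lam (updl v k sq') = l.
  by apply: min_uniq nU' nU; rewrite -h idxE xl.
apply: (@eq_from_nth _ 0%N) => [|i]; rewrite ?szsq ?sz' // => iG.
rewrite -(updl_nth v k) ?sz' // -[LHS]/(lam (updl v k sq') (Ordinal iG)) lE.
by rewrite -{1}lamE /lam updl_nth ?szsq.
Qed.

End Membership.

Definition split_idx (r d : nat) (t : 'I_r + 'I_d) : nat :=
  match t with inl i => i | inr j => (r + j)%N end.

(** The count is a sum of products of two indicators over a box. The first [r] variables hold the
    degree, the next [d] the exponent that is summed over. *)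
Lemma nfun_count (r d C : nat) (M M' : ('I_r + 'I_d -> nat) -> Prop) :
  fg M -> fg M' ->
  nfun (fun v => (count (fun sq =>
      asb (M (fun t => updl v r sq (split_idx t))) &&
      ~~ asb (M' (fun t => updl v r sq (split_idx t))))
    (boxseq d (C * \sum_(i < r) v i)))%:R).
Proof.
move=> fM fM'.
have idxk (t : 'I_r + 'I_d) : (split_idx t < r + d)%N.
  by case: t => j /=; [apply: ltn_addr | rewrite ltn_add2l].
have nP := npred_and (npred_fg idxk fM) (npred_not (npred_fg idxk fM')).
have nB : naff (fun v => (C * \sum_(i < r) v i)%N%:Z).
  apply: naff_ext (naff_scale C%:Z
    (naff_sum (index_enum 'I_r) (fun t => naff_var t))) => v.
  by rewrite -(big_morph Posz PoszD (erefl _)) PoszM.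
apply: nfun_ext (nfun_box (k := r) d nP nB _) => [v|v i y ri].
  rewrite -natr_sum -sum1_count [in RHS]big_mkcond; congr (_%:R).
congr (_ * _)%N; apply: eq_bigr => t _; rewrite updN //.
by rewrite ltn_eqF // (leq_trans (ltn_ord t)).
Qed.

(** * Piecewise quasi-polynomials *)

Section Cells.
Variable r : nat.
Implicit Types n : 'I_r -> nat.

Definition nenv n : nat -> nat :=
  fun i => if insub i is Some j then n (j : 'I_r) else 0%N.

Lemma nenvE n (j : 'I_r) : nenv n j = n j.
Proof. by rewrite /nenv valK. Qed.

(** Sums of monomials with periodic coefficients, without the common degree bound of [quasi_poly];
    this makes the closure properties direct. *)
Inductive qpoly : (('I_r -> nat) -> rat) -> Prop :=
| qpoly_mono sigma (e : 'I_r -> nat) : periodic sigma ->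
    qpoly (fun n => sigma n * \prod_(j < r) (n j)%:R ^+ e j)
| qpoly_add f g : qpoly f -> qpoly g -> qpoly (fun n => f n + g n).

Lemma qpoly_ext f g : (forall n, f n = g n) -> qpoly f -> qpoly g.
Proof. by move=> /functional_extensionality ->. Qed.

Lemma unit_vecD i a b n : unit_vec i (a + b) n = unit_vec i a (unit_vec i b n).
Proof.
apply: functional_extensionality => j; rewrite /unit_vec.
by case: eqP => // _; rewrite -addnA (addnC b).
Qed.

Lemma periodic_mull (sigma : ('I_r -> nat) -> rat) a :
  (forall n i, sigma (unit_vec i a n) = sigma n) ->
  forall k n i, sigma (unit_vec i (k * a) n) = sigma n.
Proof.
move=> h; elim=> [|k IH] n i; last by rewrite mulSn unit_vecD h.
congr sigma; apply: functional_extensionality => j; rewrite /unit_vec mul0n.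
by rewrite addn0; case: ifP.
Qed.

Lemma periodic_op (op : rat -> rat -> rat) (s t : ('I_r -> nat) -> rat) :
  periodic s -> periodic t -> periodic (fun n => op (s n) (t n)).
Proof.
move=> [a [a0 sa]] [b [b0 tb]]; exists (a * b)%N; rewrite muln_gt0 a0 b0.
split=> // n i; rewrite (periodic_mull tb) mulnC (periodic_mull sa) //.
Qed.

Lemma periodic_const c : periodic (fun _ : 'I_r -> nat => c).
Proof. by exists 1%N. Qed.

Lemma qpoly_quasi_poly f : qpoly f -> quasi_poly f.
Proof.
move=> qf.
(* The bound [D] occurs in the index type of the coefficients. Proving the claim for all large [D]
   gives two summands a common bound. *)
suff [D0 /(_ D0 (leqnn _)) h] : exists D0, forall D, (D0 <= D)%N ->
    exists sigma : {ffun 'I_r -> 'I_D.+1} -> ('I_r -> nat) -> rat,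
    (forall e, periodic (sigma e)) /\
    forall n, f n = \sum_(e : {ffun 'I_r -> 'I_D.+1} |
        (\sum_(j < r) (e j : nat) <= D)%N)
      sigma e n * \prod_(j < r) ((n j)%:R ^+ e j).
  by exists D0.
elim: qf => [sigma e sper|{}f g _ [D1 h1] _ [D2 h2]].
  exists (\sum_(j < r) e j)%N => D eD.
  exists (fun (e' : {ffun 'I_r -> 'I_D.+1}) n => if [forall j, (e' j : nat) == e j] then sigma n else 0).
  split=> [e'|n].
    by case: [forall j, _] => //; exact: periodic_const.
  pose e0 : {ffun 'I_r -> 'I_D.+1} := [ffun j => inord (e j)].
  have e0E j : (e0 j : nat) = e j.
    rewrite ffunE inordK // ltnS; apply: leq_trans eD.
    by rewrite (bigD1 j) //= leq_addr.
  rewrite (bigD1 e0) /=; last by under eq_bigr => j _ do rewrite e0E.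
  rewrite (_ : [forall j, _]); last by apply/forallP => j; rewrite e0E.
  under [X in _ = sigma n * X + _]eq_bigr => j _ do rewrite e0E.
  rewrite [X in _ = _ + X]big1 ?addr0 // => e' /andP[_ /eqP ne].
  case: ifP => [/forallP h|]; last by rewrite mul0r.
  case: ne; apply/ffunP => j; apply: val_inj.
  by rewrite /= e0E; apply/eqP.
exists (maxn D1 D2) => D; rewrite geq_max => /andP[/h1 [s1 [p1 e1]] /h2 [s2 [p2 e2]]].
exists (fun e n => s1 e n + s2 e n); split=> [e|n]; first exact: periodic_op.
by rewrite e1 e2 -big_split; apply: eq_bigr => e _; rewrite mulrDl.
Qed.

Lemma qpoly_const c : qpoly (fun=> c).
Proof.
apply: qpoly_ext (qpoly_mono (fun=> 0%N) (periodic_const c)) => n.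
by rewrite big1 ?mulr1.
Qed.

Lemma qpoly_var i f : qpoly f -> qpoly (fun n => (n i)%:R * f n).
Proof.
elim=> [sigma e sper|{}f g _ IHf _ IHg].
  apply: qpoly_ext (qpoly_mono (fun j => ((j == i) + e j)%N) sper) => n.
  rewrite mulrCA; congr (_ * _).
  under eq_bigr => j _ do rewrite exprD; rewrite big_split /=; congr (_ * _).
  rewrite (bigD1 i) //= eqxx expr1 big1 ?mulr1 // => j /negbTE ->.
  by rewrite expr0.
by apply: qpoly_ext (qpoly_add IHf IHg) => n; rewrite mulrDr.
Qed.

Lemma qpoly_periodic tau f : periodic tau -> qpoly f ->
  qpoly (fun n => tau n * f n).
Proof.
move=> tper; elim=> [sigma e sper|{}f g _ IHf _ IHg].
  have := qpoly_mono e (periodic_op *%R tper sper).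
  by apply: qpoly_ext => n; rewrite mulrA.
by apply: qpoly_ext (qpoly_add IHf IHg) => n; rewrite mulrDr.
Qed.

Definition ev (p : ('I_r -> int) * int) n : int :=
  p.2 + \sum_(j < r) p.1 j * (n j)%:Z.

Lemma aff_ev l : aff l -> exists p, forall n, l (zenv (nenv n)) = ev p n.
Proof.
elim=> [c|i|f g _ [p pE] _ [q qE]|c f _ [p pE]].
- exists (fun=> 0, c) => n; by rewrite /ev big1 ?addr0 // => j _; rewrite mul0r.
- case: (ltnP i r) => ir; last first.
    exists (fun=> 0, 0) => n; rewrite /ev big1 ?addr0 => [|j _]; last by rewrite /= mul0r.
    by rewrite /zenv /nenv insubF // ltnNge ir.
  exists (fun j => (j == Ordinal ir : nat)%:Z, 0) => n; rewrite /ev add0r.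
  rewrite (bigD1 (Ordinal ir)) //= eqxx mul1r big1 => [|j /negbTE ->].
    by rewrite addr0 /zenv -[i]/(nat_of_ord (Ordinal ir)) nenvE.
  exact: mul0r.
- exists (fun j => p.1 j + q.1 j, p.2 + q.2) => n; rewrite pE qE /ev /=.
  by under [in RHS]eq_bigr => j _ do rewrite mulrDl; rewrite big_split addrACA.
- exists (fun j => c * p.1 j, c * p.2) => n; rewrite pE /ev /= mulrDr mulr_sumr.
  by under [in RHS]eq_bigr => j _ do rewrite -mulrA.
Qed.

Lemma ev_unit_vec p i a n : ev p (unit_vec i a n) = ev p n + p.1 i * a%:Z.
Proof.
rewrite /ev -addrA; congr (_ + _).
rewrite (bigD1 i) //= [in RHS](bigD1 i) //= {1}/unit_vec eqxx PoszD mulrDr.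
rewrite addrAC; congr (_ + _ + _).
by apply: eq_bigr => j /negbTE ji; rewrite /unit_vec ji.
Qed.

(** The affine functions in the inequalities of [f] cut the space into cells, one for each sign
    vector [eps]. Inequality indicators are constant on a cell, and congruence indicators are
    periodic everywhere. *)
Lemma pfun_cells f : pfun f -> exists ls : seq (('I_r -> int) * int),
  forall eps : seq bool, exists2 q, qpoly q & forall n,
    [seq 0 <= ev p n | p <- ls] = eps -> f (zenv (nenv n)) = q n.
Proof.
elim=> [c|{}f g _ [ls1 h1] _ [ls2 h2]|i {}f _ [ls h]|l {}f al _ [ls h]
    |m l {}f al _ [ls h]].
- by exists [::] => eps; exists (fun=> c) => //; exact: qpoly_const.
- exists (ls1 ++ ls2) => eps.
  have [q1 qq1 e1] := h1 (take (size ls1) eps).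
  have [q2 qq2 e2] := h2 (drop (size ls1) eps).
  exists (fun n => q1 n + q2 n); first exact: qpoly_add.
  move=> n epsE; rewrite e1 ?e2 // -epsE map_cat.
    by rewrite drop_size_cat ?size_map.
  by rewrite take_size_cat ?size_map.
- exists ls => eps; have [q qq e] := h eps.
  case: (ltnP i r) => ir; last first.
    exists (fun=> 0) => [|n _]; first exact: qpoly_const.
    by rewrite {1}/zenv /nenv insubF ?mul0r // ltnNge ir.
  exists (fun n => (n (Ordinal ir))%:R * q n); first exact: qpoly_var.
  by move=> n /e ->; rewrite /zenv -[i]/(nat_of_ord (Ordinal ir)) nenvE.
- have [p pE] := aff_ev al.
  (* An empty sign vector belongs to no point here, and zero serves as default. *)
  exists (p :: ls) => -[|b eps]; first by exists (fun=> 0) => //; exact: qpoly_const.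
  have [q qq e] := h eps.
  exists (fun n => if b then q n else 0).
    by case: b => //; exact: qpoly_const.
  by move=> n [<- /e ->]; rewrite pE.
- have [p pE] := aff_ev al.
  exists ls => eps; have [q qq e] := h eps.
  exists (fun n => (m.+1 %| ev p n)%Z%:R * q n).
    apply: qpoly_periodic => //; exists m.+1; split=> // n i.
    by rewrite ev_unit_vec rpredDr // dvdz_mull.
  by move=> n /e ->; rewrite pE; case: ifP; rewrite ?mul1r ?mul0r.
Qed.

(** * Cells as real polyhedra *)

Definition realz (z : int) : Rdefinitions.R := Rdefinitions.IZR (ssrZ.Z_of_int z).

Lemma realzD x y : realz (x + y) = Rdefinitions.Rplus (realz x) (realz y).
Proof. by rewrite /realz -RIneq.plus_IZR; congr Rdefinitions.IZR; lia. Qed.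

Lemma realzM x y : realz (x * y) = Rdefinitions.Rmult (realz x) (realz y).
Proof. by rewrite /realz -RIneq.mult_IZR; congr Rdefinitions.IZR; lia. Qed.

Lemma realz_nat (n : nat) : realz n%:Z = Raxioms.INR n.
Proof. by rewrite /realz RIneq.INR_IZR_INZ. Qed.

Lemma realz_le x y : Rdefinitions.Rle (realz x) (realz y) <-> x <= y.
Proof.
rewrite /realz; split=> [/RIneq.le_IZR|h]; first by lia.
by apply: RIneq.IZR_le; lia.
Qed.

Lemma lin_form_realz (a : 'I_r -> int) n :
  lin_form (fun j => realz (a j)) n = realz (\sum_(j < r) a j * (n j)%:Z).
Proof.
rewrite /lin_form -big_enum; elim: (enum 'I_r) => [|j s IH] /=.
  by rewrite big_nil.
by rewrite big_cons IH realzD realzM realz_nat.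
Qed.

(** Polyhedra are closed. At integer points the strict inequality [ev p n < 0] is the closed one
    [ev p n <= -1], hence the [- 1] in the second branch. *)
Definition halfspace (p : ('I_r -> int) * int) (b : bool) :
    ('I_r -> Rdefinitions.R) * Rdefinitions.R :=
  if b then (fun j => realz (- p.1 j), realz p.2)
  else (fun j => realz (p.1 j), realz (- p.2 - 1)).

Lemma halfspaceP p b n :
  Rdefinitions.Rle (lin_form (halfspace p b).1 n) (halfspace p b).2 <->
  (0 <= ev p n) = b.
Proof.
rewrite /halfspace /ev; case: b; rewrite lin_form_realz realz_le /=.
  have -> : \sum_(j < r) - p.1 j * (n j)%:Z = - \sum_(j < r) p.1 j * (n j)%:Z.
    by rewrite -sumrN; apply: eq_bigr => j _; rewrite mulNr.
  by rewrite -subr_ge0 opprK.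
set s := \sum_(j < r) _; split=> h.
  by apply/negbTE; rewrite -ltNge; lia.
by move/negbT: h; rewrite -ltNge; lia.
Qed.

Lemma in_polyhedron_cell (ls : seq (('I_r -> int) * int)) (eps : seq bool) n :
  size eps = size ls ->
  in_polyhedron [seq halfspace p.1 p.2 | p <- zip ls eps] n <->
  [seq 0 <= ev p n | p <- ls] = eps.
Proof.
rewrite /in_polyhedron; elim: ls eps => [|p ls IH] [|b eps] //= [sz].
split=> [h|[/halfspaceP hb heps] h [<-//|]]; last exact: (IH _ sz).2.
have -> : (0 <= ev p n) = b by apply/halfspaceP; apply: h; left.
by rewrite (IH _ sz).1 // => hs hin; apply: h; right.
Qed.

(** The pieces are indexed by all sign vectors. They are disjoint and cover everything because each
    point has exactly one sign vector; empty pieces do no harm. *)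
Lemma nfun_piecewise f : nfun f -> piecewise_quasi_poly (fun n => f (nenv n)).
Proof.
move=> [g [pg fE]]; have [ls lsP] := pfun_cells pg.
pose k := size ls.
have := fun i : 'I_#|{: k.-tuple bool}| => lsP (val (enum_val i)).
move=> /fin_all_exists2 [q qq qE].
exists #|{: k.-tuple bool}|,
  (fun i => [seq halfspace p.1 p.2 | p <- zip ls (val (enum_val i))]), q.
have sz (i : 'I_#|{: k.-tuple bool}|) : size (val (enum_val i)) = size ls.
  exact: size_tuple.
split=> [i|n|n i i' /(in_polyhedron_cell _ (sz i)) h
         /(in_polyhedron_cell _ (sz i'))|i n /(in_polyhedron_cell _ (sz i))].
- exact: qpoly_quasi_poly.
- have st : size [seq 0 <= ev p n | p <- ls] == k by rewrite size_map.
  exists (enum_rank (Tuple st)); apply/in_polyhedron_cell => //.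
  by rewrite enum_rankK.
- by rewrite h => /val_inj /enum_val_inj.
- by move=> /qE <-; rewrite fE.
Qed.

End Cells.

(** * Monomial ideals and their saturations *)

Section MonomialIdeals.
Variables (K : fieldType) (d : nat).
Local Notation P := {mpoly K[d]}.
Local Notation mon := 'X_{1..d}.
Implicit Types (E : mon -> Prop) (I J : P -> Prop) (m : mon) (f g : P).

Definition upclosed E := forall m m', E m -> E (m + m')%MM.

Lemma upclosed_le E m m' : upclosed E -> (m <= m')%MM -> E m -> E m'.
Proof. by move=> uE le Em; rewrite -(submK le) addmC; apply: uE. Qed.

Definition mideal E f := forall m, m \in msupp f -> E m.

Definition expset I E := upclosed E /\ forall f, I f <-> mideal E f.

Lemma mideal0 E : mideal E 0.
Proof. by move=> m; rewrite msupp0. Qed.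

Lemma midealD E f g : mideal E f -> mideal E g -> mideal E (f + g).
Proof.
by move=> hf hg m /msuppD_le; rewrite mem_cat => /orP[/hf|/hg].
Qed.

Lemma midealM E f g : upclosed E -> mideal E g -> mideal E (f * g).
Proof.
move=> uE hg m /msuppM_le /allpairsP[[a b] /= [_ bg ->]].
by rewrite addmC; apply: uE; apply: hg.
Qed.

Lemma mideal_ideal E : upclosed E -> is_ideal (mideal E).
Proof.
by move=> uE; split; [exact: mideal0 | exact: midealD | move=> c a; exact: midealM].
Qed.

Lemma midealX E m : mideal E 'X_[m] <-> E m.
Proof.
split=> [|Em m']; first by apply; rewrite msuppX mem_seq1.
by rewrite msuppX mem_seq1 => /eqP ->.
Qed.

Lemma gen_ideal_is_ideal (S : P -> Prop) : is_ideal (gen_ideal S).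
Proof.
split=> [L [L0 _ _] _|a b ha hb L iL SL|c a ha L iL SL] //; case: (iL) => L0 LD LM.
  by apply: LD; [apply: ha | apply: hb].
by apply: LM; apply: ha.
Qed.

Lemma ideal_sum I (s : seq mon) (F : mon -> P) : is_ideal I ->
  (forall m, m \in s -> I (F m)) -> I (\sum_(m <- s) F m).
Proof.
move=> [I0 ID _] h; rewrite big_seq; elim/big_ind: _ => // m /h //.
Qed.

Lemma ideal_supp I f : is_ideal I ->
  (forall m, m \in msupp f -> I 'X_[m]) -> I f.
Proof.
move=> iI h; rewrite (mpolyE f); apply: ideal_sum => // m /h Im.
by rewrite -mul_mpolyC; case: iI => _ _; apply.
Qed.

Lemma monomial_expset I : monomial_ideal I -> exists E, expset I E.
Proof.
move=> [M IM]; pose E m := exists2 m0, M m0 & (m0 <= m)%MM.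
have uE : upclosed E.
  move=> m m' [m0 Mm0 le]; exists m0 => //.
  exact: lepm_trans le (lem_addr _ _).
exists E; split=> // f; rewrite IM; split.
  apply; first exact: mideal_ideal.
  by move=> _ [m [Mm ->]]; apply/midealX; exists m => //; exact: lepm_refl.
move=> hf; apply: ideal_supp; first exact: gen_ideal_is_ideal.
move=> m /hf [m0 Mm0 le] L [_ _ LM] SL.
by rewrite -(submK le) mpolyXD; apply: LM; apply: SL; exists m0.
Qed.

Definition esum E E' m := exists a b, [/\ E a, E' b & m = (a + b)%MM].

Lemma expset_mul I J E E' : expset I E -> expset J E' ->
  expset (ideal_mul I J) (esum E E').
Proof.
move=> [uE IE] [uE' JE'].
have uS : upclosed (esum E E').
  move=> m m' [a [b [Ea Eb ->]]]; exists a, (b + m')%MM; split=> //.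
    exact: uE'.
  by rewrite addmA.
split=> // f; split.
  apply; first exact: mideal_ideal.
  move=> _ [a [b [/IE Ia /JE' Jb ->]]] m /msuppM_le /allpairsP[[a' b'] /= [ha hb ->]].
  by exists a', b'; split; [apply: Ia | apply: Jb |].
move=> hf; apply: ideal_supp; first exact: gen_ideal_is_ideal.
move=> m /hf [a [b [Ea Eb ->]]] L _; apply.
exists 'X_[a], 'X_[b]; rewrite mpolyXD; split=> //.
  exact/IE/midealX.
exact/JE'/midealX.
Qed.

Definition etrue : mon -> Prop := fun=> True.

Lemma expset_unit : expset (@unit_ideal P) etrue.
Proof. by []. Qed.

Fixpoint epow E k : mon -> Prop := if k is k'.+1 then esum (epow E k') E else etrue.

Lemma expset_pow I E k : expset I E -> expset (ideal_pow I k) (epow E k).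
Proof.
by move=> IE; elim: k => [|k IH] /=; [exact: expset_unit | exact: expset_mul].
Qed.

Definition emulti r (Es : 'I_r -> mon -> Prop) (n : 'I_r -> nat)
  (s : seq 'I_r) : mon -> Prop :=
  foldr (fun i acc => esum acc (epow (Es i) (n i))) etrue s.

Lemma expset_multipow r (Is : 'I_r -> P -> Prop) Es n :
  (forall i, expset (Is i) (Es i)) ->
  expset (ideal_multipow Is n) (emulti Es n (enum 'I_r)).
Proof.
move=> h; rewrite /ideal_multipow; elim: (enum 'I_r) => [|i s IH] /=.
  exact: expset_unit.
by apply: expset_mul => //; exact: expset_pow.
Qed.

(** * Saturation in terms of exponents *)

Definition mpart (p : pred mon) f := \sum_(m <- msupp f | p m) f@_m *: 'X_[m].

Lemma mcoeff_mpart p f m : (mpart p f)@_m = if p m then f@_m else 0.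
Proof.
rewrite /mpart raddf_sum /=.
under eq_bigr => m' _ do rewrite mcoeffZ mcoeffX.
case: (boolP (m \in msupp f)) => mf; last first.
  rewrite (memN_msupp_eq0 mf) if_same big1_seq // => m' /andP[_ m'f].
  by case: eqP m'f => [->|_]; rewrite ?(negbTE mf) ?mulr0.
rewrite big_mkcond (bigD1_seq m) ?msupp_uniq //= eqxx mulr1 big1 ?addr0 //.
by move=> m' /negbTE ->; rewrite mulr0; case: ifP.
Qed.

Lemma msupp_mpart p f m : (m \in msupp (mpart p f)) = p m && (m \in msupp f).
Proof.
by rewrite !mcoeff_msupp mcoeff_mpart; case: (p m); rewrite ?eqxx.
Qed.

Lemma mpartE p f : f = mpart p f + mpart (predC p) f.
Proof.
apply/mpolyP => m; rewrite mcoeffD !mcoeff_mpart /=.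
by case: (p m); rewrite ?addr0 ?add0r.
Qed.

(** The exponents of [I : (X^mu)^oo] when [E] is the exponent set of [I]. *)
Definition ecolon E (mu : mon) m := exists k, E (m + mu *+ k)%MM.

Lemma upclosed_ecolon E mu : upclosed E -> upclosed (ecolon E mu).
Proof.
move=> uE m m' [k Ek]; exists k; rewrite -addmA (addmC m') addmA.
exact: uE.
Qed.

(* The variables occurring in [mu] act invertibly modulo [ecolon E mu], so the
   lowest weight part of [g] for the degree in the other variables, which
   contains [mu], is a nonzerodivisor; leading terms finish the argument. *)
Lemma mideal_colon_cancel E mu f g : upclosed E -> mu \in msupp g ->
  mideal (ecolon E mu) (f * g) -> mideal (ecolon E mu) f.
Proof.
move=> uE mug fgE; have uC := @upclosed_ecolon E mu uE.
(* It suffices that the part [f1] of [f] with exponents outside [ecolon E mu] vanishes. The rest of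
   [f] lies in the ideal, so [f1 * g] does too. *)
pose bad m := ~~ asb (ecolon E mu m); pose f1 := mpart bad f.
have f1P m : m \in msupp f1 -> ~ ecolon E mu m.
  by rewrite msupp_mpart => /andP[/asbP].
have f1g : mideal (ecolon E mu) (f1 * g).
  pose f2 := mpart (predC bad) f.
  have -> : f1 * g = f * g + (- 1) * (f2 * g).
    have fE : f = f1 + f2 by exact: mpartE.
    by rewrite [in RHS]fE mulrDl mulN1r addrK.
  apply: midealD => //; apply: midealM => //; rewrite mulrC; apply: midealM => //.
  by move=> m; rewrite msupp_mpart /= negbK => /andP[/asbP].
have [f10|f1n0] := eqVneq f1 0.
  move=> m mf; apply: NNPP => nm.
  have : m \in msupp f1 by rewrite msupp_mpart mf andbT; apply/asbP.
  by rewrite f10 msupp0.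
exfalso.
(* The degree in the variables that do not divide [X^mu]; in particular [mu] has weight zero. *)
pose wt m := (\sum_(i | mu i == 0%N) m i)%N.
have wtD m m' : wt (m + m')%MM = (wt m + wt m')%N.
  by rewrite /wt -big_split; apply: eq_bigr => i _; rewrite mnmDE.
have exw : exists w, has (fun m => wt m == w) (msupp f1).
  exists (wt (mlead f1)); apply/hasP; exists (mlead f1) => //.
  exact: mlead_supp.
case: (ex_minnP exw) => w0 /hasP[m0 m0f /eqP wm0] w0min.
have w0le m : m \in msupp f1 -> (w0 <= wt m)%N.
  by move=> mf; apply: w0min; apply/hasP; exists m.
pose f0 := mpart (fun m => wt m == w0) f1.
pose g0 := mpart (fun m => wt m == 0%N) g.
have f0n0 : f0 != 0.
  apply/eqP => h; have : m0 \in msupp f0 by rewrite msupp_mpart m0f wm0 eqxx.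
  by rewrite h msupp0.
have g0n0 : g0 != 0.
  apply/eqP => h; have : mu \in msupp g0.
    by rewrite msupp_mpart mug andbT /wt big1 // => i /eqP.
  by rewrite h msupp0.
have := mlead_supp f0n0; rewrite msupp_mpart => /andP[/eqP wa af1].
have := mlead_supp g0n0; rewrite msupp_mpart => /andP[/eqP wb bg].
set a := mlead f0 in wa af1; set b := mlead g0 in wb bg.
(* In weight [w0] only the lowest part [f0] of [f1] and the weight zero part [g0] of [g] contribute,
   so this coefficient is a product of two leading coefficients. *)
have abfg : (f1 * g)@_(a + b) = (f0 * g0)@_(a + b).
  rewrite {1}(mpartE (fun m => wt m == w0) f1) -/f0.
  rewrite {1}(mpartE (fun m => wt m == 0%N) g) -/g0.
  rewrite mulrDl mulrDr !mcoeffD -addrA -[RHS]addr0; congr (_ + _).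
  have wab : wt (a + b)%MM = w0 by rewrite wtD wa wb addn0.
  rewrite !(memN_msupp_eq0 (m := (a + b)%MM)) ?addr0 //; apply/negP.
    move=> /msuppM_le /allpairsP[[a' b'] /= [a'f _ e]].
    move: a'f wab; rewrite msupp_mpart e wtD /= => /andP[/eqP wa' /w0le].
    by move: wa'; lia.
  move=> /msuppM_le /allpairsP[[a' b'] /= [a'f b'g e]].
  move: a'f b'g wab; rewrite (msupp_mpart _ g) (msupp_mpart _ f1) e wtD /= => /andP[/eqP -> _].
  by case/andP => /eqP wb' _ h; apply: wb'; lia.
have : (f1 * g)@_(a + b) != 0.
  by rewrite abfg mleadcM mulf_neq0 // mleadc_eq0.
rewrite -mcoeff_msupp => /f1g [k Ek]; apply: (f1P a) => //.
(* As [b] has weight zero, it involves only variables of [mu], and the additional multiple of [mu]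
   dominates it. *)
exists (k + \sum_i b i)%N.
apply: upclosed_le uE _ Ek; apply/mnm_lepP => i; rewrite !mnmDE !mulmnE.
rewrite -addnA leq_add2l mulnDr addnC leq_add2l.
have [mui|mui] := eqVneq (mu i) 0%N.
  move: wb; rewrite /wt (bigD1 i) ?mui //=; lia.
rewrite (bigD1 i) //=; nia.
Qed.

Definition supp_of J (mu : mon) := exists2 g, J g & mu \in msupp g.

Definition esat E J m := forall mu, supp_of J mu -> ecolon E mu m.

Lemma mem_ideal_pow I k g : I g -> ideal_pow I k (g ^+ k).
Proof.
move=> Ig; elim: k => [|k IH] //= L _; apply.
by exists (g ^+ k), g; rewrite exprSr.
Qed.

Lemma ideal_pow_sub I J k f : (forall g, I g -> J g) ->
  ideal_pow I k f -> ideal_pow J k f.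
Proof.
move=> h; elim: k f => [|k IH] f //= hf L iL SL.
apply: hf => // _ [a [b [ha hb ->]]]; apply: SL; exists a, b.
by split=> //; [exact: IH | exact: h].
Qed.

Lemma dickson_mnm E : exists (s : nat) (v : 'I_s -> mon),
  (forall i, E (v i)) /\ forall m, E m -> exists i, (v i <= m)%MM.
Proof.
have [s [v [vE vP]]] := dickson (fun x : 'I_d -> nat => E [multinom x j | j < d]).
exists s, (fun i => [multinom v i j | j < d]); split=> // m Em.
have mE : [multinom m j | j < d] = m by apply/mnmP => j; rewrite mnmE.
have [i vi] := vP m (eq_ind_r E Em mE).
by exists i; apply/mnm_lepP => j; rewrite mnmE.
Qed.

(** Each of the [K'] summands of [m] lies above some [v i], and [c i] counts how often [v i] is
    chosen. *)
Lemma epow_pigeonhole E s (v : 'I_s -> mon) K' m :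
  (forall m, E m -> exists i, (v i <= m)%MM) -> epow E K' m ->
  exists c : 'I_s -> nat, (\sum_i c i)%N = K' /\
    forall i, (v i *+ c i <= m)%MM.
Proof.
move=> vP Em.
suff [c [cK cm]] : exists c : 'I_s -> nat, (\sum_i c i)%N = K' /\
    forall j, (\sum_i v i j * c i <= m j)%N.
  exists c; split=> // i; apply/mnm_lepP => j; rewrite mulmnE.
  by apply: leq_trans (cm j); rewrite (bigD1 i) //= leq_addr.
elim: K' m Em => [|k IH] m /=.
  exists (fun=> 0%N); rewrite big1 //; split=> // j; rewrite big1 // => i _.
  by rewrite muln0.
case=> a [b [/IH [c [ck ca]] /vP [i vb] ->]].
exists (fun j => (c j + (j == i))%N); split.
  rewrite big_split /= ck (bigD1 i) //= eqxx big1 ?addn0 ?addn1 //.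
  by move=> j /negbTE ->.
move=> j; rewrite mnmDE.
under eq_bigr => i' _ do rewrite mulnDr.
rewrite big_split; apply: leq_add (ca j) _.
rewrite (bigD1 i) //= eqxx muln1 big1 ?addn0; first exact: mnm_lepP vb j.
by move=> i' /negbTE ->; rewrite muln0.
Qed.

Lemma seq_uniform_bound (A : eqType) (s : seq A) (Q : A -> nat -> Prop) :
  (forall x k k', (k <= k')%N -> Q x k -> Q x k') ->
  (forall x, x \in s -> exists k, Q x k) ->
  exists k, forall x, x \in s -> Q x k.
Proof.
move=> mono; elim: s => [|a s IH] h; first by exists 0%N.
have [k hk] : exists k, forall x, x \in s -> Q x k.
  by apply: IH => x xs; apply: h; rewrite inE xs orbT.
have [k' hk'] := h a (mem_head _ _).
exists (maxn k k') => x; rewrite inE => /orP[/eqP ->|/hk].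
  exact: mono (leq_maxr _ _) hk'.
exact: mono (leq_maxl _ _).
Qed.

Lemma upclosed_mulm_le E m mu k k' : upclosed E -> (k <= k')%N ->
  E (m + mu *+ k)%MM -> E (m + mu *+ k')%MM.
Proof.
move=> uE kk; apply: upclosed_le => //; apply/mnm_lepP => j.
by rewrite !mnmDE !mulmnE leq_add2l leq_mul2l kk orbT.
Qed.

Lemma ecolon_le E mu mu' m : upclosed E -> (mu <= mu')%MM ->
  ecolon E mu m -> ecolon E mu' m.
Proof.
move=> uE le [k Ek]; exists k; apply: upclosed_le Ek => //.
apply/mnm_lepP => j; rewrite !mnmDE !mulmnE leq_add2l leq_mul2r.
by rewrite (mnm_lepP le) orbT.
Qed.

(** If [f J^k] lies in [I], then so does [f g^k] for each [g] in [J], and [mideal_colon_cancel]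
    removes the factors [g] one by one. Conversely, finitely many [v i] lie below all monomials of
    [J], and one [k] serves all of them and all monomials of [f]. *)
Lemma expset_saturation I J E : expset I E -> expset (saturation I J) (esat E J).
Proof.
move=> [uE IE]; split.
  by move=> m m' h mu /h; exact: upclosed_ecolon.
move=> f; split.
  move=> [k hk] m mf mu [g Jg mug].
  have : mideal (ecolon E mu) (f * g ^+ k).
    move=> m' h; exists 0%N; rewrite addm0.
    by have /IE := hk _ (mem_ideal_pow k Jg); apply.
  suff : forall k f, mideal (ecolon E mu) (f * g ^+ k) -> mideal (ecolon E mu) f.
    by move=> h /h; apply.
  elim=> [|k' IH] f'; first by rewrite expr0 mulr1.
  by rewrite exprS mulrA => /IH; exact: mideal_colon_cancel.
move=> hf.
pose EJ m := exists2 mu, supp_of J mu & (mu <= m)%MM.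
have uEJ : upclosed EJ.
  move=> m m' [mu Jmu le]; exists mu => //.
  exact: lepm_trans le (lem_addr _ _).
have [s [v [vE vP]]] := dickson_mnm EJ.
have [k kP] : exists k, forall m, m \in msupp f ->
    forall i, E (m + v i *+ k)%MM.
  apply: seq_uniform_bound => [m k k' kk h i|m mf].
    exact: upclosed_mulm_le (h i).
  have [k kP] : exists k, forall i, i \in enum 'I_s -> E (m + v i *+ k)%MM.
    apply: seq_uniform_bound => [i k k' kk|i _]; first exact: upclosed_mulm_le.
    have [mu Jmu le] := vE i; exact: ecolon_le le (hf m mf mu Jmu).
  by exists k => i; apply: kP; rewrite mem_enum.
(* In a product of [s * k + 1] factors one of the [s] exponents [v i] is chosen at least [k]
   times. *)
exists (s * k).+1 => g gJ; apply/IE => m /msuppM_le /allpairsP[[a b] /= [af bg ->]].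
have EJP : expset (mideal EJ) EJ by [].
have [_ /(_ g) [hg _]] := expset_pow (s * k).+1 EJP.
have Jsub g' : J g' -> mideal EJ g'.
  by move=> Jg' mu mug; exists mu; [exists g' | exact: lepm_refl].
have /(_ b bg) Eb := hg (ideal_pow_sub Jsub gJ).
have [c [cS cb]] := epow_pigeonhole vP Eb.
have [i ki] : exists i, (k <= c i)%N.
  apply: NNPP => h; have : (\sum_i c i <= s * k)%N.
    rewrite -[X in (_ <= X * k)%N]card_ord -sum_nat_const; apply: leq_sum => i _.
    by rewrite leqNgt; apply/negP => lt; apply: h; exists i; apply: ltnW.
  by rewrite cS ltnn.
apply: upclosed_le uE _ (kP a af i); apply/mnm_lepP => j.
rewrite !mnmDE leq_add2l; apply: leq_trans (mnm_lepP (cb i) j).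
by rewrite !mulmnE leq_mul2l ki orbT.
Qed.

End MonomialIdeals.

(** * The Rees monoid and the symbolic Rees monoid *)

(** The generated submonoid, built one generator at a time and thus suited to induction; [fg] works
    with coefficient vectors instead. *)
Inductive mspan (T : Type) (S : (T -> nat) -> Prop) : (T -> nat) -> Prop :=
| mspan0 : mspan S (@vzero T)
| mspanD x y : S x -> mspan S y -> mspan S (vadd x y).

Lemma vadd0 (T : Type) (x : T -> nat) : vadd x (@vzero T) = x.
Proof. by apply: functional_extensionality => t; rewrite /vadd addn0. Qed.

Lemma vaddC (T : Type) (x y : T -> nat) : vadd x y = vadd y x.
Proof. by apply: functional_extensionality => t; rewrite /vadd addnC. Qed.

Lemma vaddA (T : Type) (x y z : T -> nat) :
  vadd x (vadd y z) = vadd (vadd x y) z.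
Proof. by apply: functional_extensionality => t; rewrite /vadd addnA. Qed.

Lemma mspan_add (T : Type) (S : (T -> nat) -> Prop) x y :
  mspan S x -> mspan S y -> mspan S (vadd x y).
Proof.
move=> hx hy; elim: hx => [|a b Sa _ IH]; first by rewrite vaddC vadd0.
by rewrite -vaddA; apply: mspanD.
Qed.

Lemma fg_mspan (T : Type) (H : finType) (s : H -> T -> nat) :
  fg (mspan (fun x => exists h, x = s h)).
Proof.
exists #|H|, (fun i => s (enum_val i)) => x; split.
  elim=> [|_ b [h ->] _ [l ->]]; first by exists (@vzero _); rewrite comb_zero.
  exists (vadd (fun j => (j == enum_rank h : nat)) l).
  by rewrite comb_add comb_delta enum_rankK.
case=> l ->.
have -> : comb (fun i : 'I_#|H| => s (enum_val i)) l =
    \big[@vadd T/@vzero T]_(i < #|H|) (fun t => (l i * s (enum_val i) t)%N).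
  by apply: functional_extensionality => t; rewrite /comb; elim/big_rec2: _ => // i a b _ ->.
elim/big_ind: _ => [|a b|i _]; [exact: mspan0 | exact: mspan_add |].
elim: (l i) => [|n IH]; first exact: mspan0.
have -> : (fun t => (n.+1 * s (enum_val i) t)%N) =
    vadd (s (enum_val i)) (fun t => (n * s (enum_val i) t)%N).
  by apply: functional_extensionality => t; rewrite mulSn.
by apply: mspanD => //; exists (enum_val i).
Qed.

Section ReesMonoid.
Variables (d r : nat) (Es : 'I_r -> 'X_{1..d} -> Prop).
Hypothesis uEs : forall i, upclosed (Es i).
Implicit Types (n : 'I_r -> nat) (m : 'X_{1..d}).

Definition vec n m : 'I_r + 'I_d -> nat :=
  fun t => match t with inl i => n i | inr j => m j end.
Definition nvec (x : 'I_r + 'I_d -> nat) : 'I_r -> nat := x \o inl.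
Definition mvec (x : 'I_r + 'I_d -> nat) : 'X_{1..d} := [multinom x (inr j) | j < d].

Lemma vecK x : vec (nvec x) (mvec x) = x.
Proof.
by apply: functional_extensionality => -[i|j] //=; rewrite mnmE.
Qed.

Lemma mvec_vec n m : mvec (vec n m) = m.
Proof. by apply/mnmP => j; rewrite mnmE. Qed.

Lemma vec_add n n' m m' : vec (vadd n n') (m + m')%MM = vadd (vec n m) (vec n' m').
Proof.
by apply: functional_extensionality => -[i|j] //; rewrite /vadd /= mnmDE.
Qed.

Lemma vec0 : vec (@vzero _) 0%MM = @vzero _.
Proof. by apply: functional_extensionality => -[i|j] //=; rewrite mnm0E. Qed.

Definition rees n m := emulti Es n (enum 'I_r) m.

Lemma upclosed_esum E E' : upclosed E' -> upclosed (esum (d := d) E E').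
Proof.
move=> uE m m' [a [b [Ea Eb ->]]]; exists a, (b + m')%MM.
by split=> //; [exact: uE | rewrite addmA].
Qed.

Lemma upclosed_epow E k : upclosed E -> upclosed (epow (d := d) E k).
Proof. by move=> uE; case: k => [|k] //=; exact: upclosed_esum. Qed.

Lemma upclosed_emulti n s : upclosed (emulti Es n s).
Proof. by case: s => [|i s] //=; apply/upclosed_esum/upclosed_epow. Qed.

Lemma epow_add E k k' m m' : upclosed E ->
  epow E k m -> epow E k' m' -> epow E (k + k') (m + m')%MM.
Proof.
move=> uE Em; elim: k' m' => [|k' IH] m' /=.
  by rewrite addn0 => _; apply: upclosed_epow.
rewrite addnS => -[a [b [Ea Eb ->]]] /=; exists (m + a)%MM, b.
by split=> //; [exact: IH | rewrite addmA].
Qed.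

Lemma emulti_add n n' s m m' :
  emulti Es n s m -> emulti Es n' s m' -> emulti Es (vadd n n') s (m + m')%MM.
Proof.
elim: s m m' => //= i s IH m m' [a [b [Ea Eb ->]]] [a' [b' [Ea' Eb' ->]]].
exists (a + a')%MM, (b + b')%MM; split; [exact: IH | exact: epow_add |].
by apply/mnmP => j; rewrite !mnmDE addnACA.
Qed.

Lemma emulti0 n s m : (forall i, i \in s -> n i = 0%N) -> emulti Es n s m.
Proof.
elim: s m => //= i s IH m h; exists m, 0%MM; rewrite addm0 h ?mem_head //.
by split=> //; apply: IH => j js; rewrite h // inE js orbT.
Qed.

Lemma emulti_delta i s m : uniq s -> Es i m ->
  emulti Es (fun j => (j == i : nat)) s m.
Proof.
move=> + Em; elim: s => //= j s IH /andP[js us].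
have [ji|ji] := eqVneq j i; last first.
  by exists m, 0%MM; rewrite addm0; split=> //; exact: IH.
exists 0%MM, m; rewrite add0m ji; split=> //; last by exists 0%MM, m; rewrite add0m.
by apply: emulti0 => j' j's; case: eqP => // j'i; rewrite j'i -ji (negbTE js) in j's.
Qed.

Lemma reesD n n' m m' : rees n m -> rees n' m' -> rees (vadd n n') (m + m')%MM.
Proof. exact: emulti_add. Qed.

Lemma rees0 m : rees (@vzero _) m.
Proof. exact: emulti0. Qed.

(** The generators are the variables in degree zero and, for each [i], finitely many generators of
    the [i]-th ideal in the unit degree [e_i]. Powers and products are decomposed factor by
    factor. *)
Lemma fg_rees : fg (fun x => rees (nvec x) (mvec x)).
Proof.
have := fun i => dickson_mnm (Es i).
move=> /fin_all_exists [k] /fin_all_exists [g gP].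
have gE i := (gP i).1; have gle i := (gP i).2.
pose H : finType := ('I_d + {i : 'I_r & 'I_(k i)})%type.
pose s (h : H) := match h with
  | inl j => vec (@vzero _) U_(j)%MM
  | inr (existT i a) => vec (fun j => (j == i : nat)) (g i a) end.
apply: fg_ext (fg_mspan s) => x; split.
  elim=> [|_ y [h ->] _ IH].
    by rewrite -vec0 mvec_vec; exact: rees0.
  have -> : mvec (vadd (s h) y) = (mvec (s h) + mvec y)%MM.
    by apply/mnmP => j; rewrite mnmDE !mnmE.
  apply: (@reesD (nvec (s h)) (nvec y)) => //.
  case: h => [j|[i a]] /=; rewrite mvec_vec; first exact: rees0.
  by apply: emulti_delta; rewrite ?enum_uniq.
pose S x := exists h, x = s h.
have span0 m : mspan S (vec (@vzero _) m).
  have [w] := ubnP (mdeg m); elim: w m => // w IH m mw.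
  have [->|m0] := eqVneq m 0%MM; first by rewrite vec0; exact: mspan0.
  have [j mj] : exists j, (U_(j) <= m)%MM.
    apply: NNPP => h; case/eqP: m0; apply/mnmP => j; rewrite mnm0E.
    apply/eqP/negPn/negP => mj; apply: h; exists j; by rewrite lep1mP.
  rewrite -(submK mj) addmC.
  have -> : @vzero 'I_r = vadd (@vzero _) (@vzero _) by rewrite vadd0.
  rewrite vec_add; apply: mspanD; first by exists (inl j).
  apply: IH; move: mw; rewrite -{1}(submK mj) mdegD mdeg1; lia.
have spanE i m : Es i m -> mspan S (vec (fun j => (j == i : nat)) m).
  move=> /gle [a le]; rewrite -(submK le) addmC.
  rewrite -[fun j => _](vadd0 (fun j => (j == i : nat))) vec_add; apply: mspanD => //.
  by exists (inr (existT _ i a)).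
have spanP i q m : epow (Es i) q m -> mspan S (vec (fun j => (q * (j == i))%N) m).
  elim: q m => [|q IH] m /=; first by move=> _; exact: span0.
  move=> [a [b [/IH ha /spanE hb ->]]].
  have -> : (fun j => (q.+1 * (j == i))%N) =
      vadd (fun j => (q * (j == i))%N) (fun j => (j == i : nat)).
    by apply: functional_extensionality => j; rewrite /vadd mulSn addnC.
  by rewrite vec_add; apply: mspan_add.
(* Only the indices in [u] have been multiplied in so far, so the degree is [n] restricted to
   [u]. *)
have spanM n u m : uniq u -> emulti Es n u m ->
    mspan S (vec (fun j => ((j \in u) * n j)%N) m).
  elim: u m => [|i u IH] m /= => [_ _|/andP[iu uu] [a [b [/(IH _ uu) ha /spanP hb ->]]]].
    exact: span0.
  have -> : (fun j => ((j \in i :: u) * n j)%N) =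
      vadd (fun j => ((j \in u) * n j)%N) (fun j => (n i * (j == i))%N).
    apply: functional_extensionality => j; rewrite /vadd inE.
    by case: eqP => [->|_] /=; rewrite ?(negbTE iu); lia.
  by rewrite vec_add; apply: mspan_add.
move=> /(spanM _ _ _ (enum_uniq _)).
have -> : (fun j => ((j \in enum 'I_r) * nvec x j)%N) = nvec x.
  by apply: functional_extensionality => j; rewrite mem_enum mul1n.
by rewrite vecK.
Qed.

(** Replacing each factor by a generator below it leaves a product of generators, one for each unit
    of degree; [C] is the sum of the degrees of all generators. *)
Lemma rees_bounded : exists C : nat, forall n m, rees n m ->
  exists p, [/\ (p <= m)%MM, rees n p & forall j, (p j <= C * \sum_(i < r) n i)%N].
Proof.
have := fun i => dickson_mnm (Es i).
move=> /fin_all_exists [k] /fin_all_exists [g gP].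
have gE i := (gP i).1; have gle i := (gP i).2.
pose C := (\sum_i \sum_(a < k i) mdeg (g i a))%N.
have gC i a j : (g i a j <= C)%N.
  rewrite /C (bigD1 i) //= (bigD1 a) //= mdegE (bigD1 j) //=; lia.
exists C => n m.
have powC i q m' : epow (Es i) q m' ->
    exists p, [/\ (p <= m')%MM, epow (Es i) q p & forall j, (p j <= C * q)%N].
  elim: q m' => [|q IH] m' /=.
    move=> _; exists 0%MM; split=> // [|j]; last by rewrite mnm0E.
    by apply/mnm_lepP => j; rewrite mnm0E.
  move=> [a [b [/IH [p [pa Ep pC]] /gle [c cb] ->]]].
  exists (p + g i c)%MM; split.
  - apply/mnm_lepP => j; rewrite !mnmDE.
    exact: leq_add (mnm_lepP pa j) (mnm_lepP cb j).
  - by exists p, (g i c).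
  - by move=> j; rewrite mnmDE mulnS addnC leq_add.
rewrite /rees -big_enum /=; elim: (enum 'I_r) m => [|i s IH] m /=.
  move=> _; exists 0%MM; split=> // [|j]; last by rewrite mnm0E.
  by apply/mnm_lepP => j; rewrite mnm0E.
move=> [a [b [/IH [p [pa Ep pC]] /powC [q [qb Eq qC]] ->]]].
exists (p + q)%MM; split.
- apply/mnm_lepP => j; rewrite !mnmDE.
  exact: leq_add (mnm_lepP pa j) (mnm_lepP qb j).
- by exists p, q.
- by move=> j; rewrite mnmDE big_cons mulnDr addnC leq_add.
Qed.

Variables (K : fieldType) (J : {mpoly K[d]} -> Prop).

Definition symrees n m := esat (rees n) J m.

(** By Dickson's lemma the intersection over all monomials occurring in [J] reduces to finitely many
    exponents [v i], each giving a colon monoid of the Rees monoid in direction [(0, v i)]. *)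
Lemma fg_symrees : fg (fun x => symrees (nvec x) (mvec x)).
Proof.
have urees n : upclosed (rees n) by exact: upclosed_emulti.
have [s [v [vE vP]]] := dickson_mnm (fun m => exists2 mu, supp_of J mu & (mu <= m)%MM).
apply: fg_ext (fg_bigcap (fun i => fg_colon (vec (@vzero _) (v i)) fg_rees)) => x.
have nE i k : nvec (fun t => (x t + k * vec (@vzero _) (v i) t)%N) = nvec x.
  by apply: functional_extensionality => j; rewrite /nvec /= muln0 addn0.
have mE i k : mvec (fun t => (x t + k * vec (@vzero _) (v i) t)%N) =
    (mvec x + v i *+ k)%MM.
  by apply/mnmP => j; rewrite mnmDE mulmnE !mnmE /= mulnC.
split=> [h mu Jmu|h i].
  have [i le] : exists i, (v i <= mu)%MM.
    by apply: vP; exists mu => //; exact: lepm_refl.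
  apply: ecolon_le le _; first exact: urees.
  by have [k] := h i; rewrite nE mE => hk; exists k.
have [mu Jmu le] := vE i.
have [k hk] : ecolon (rees (nvec x)) (v i) (mvec x).
  exact: ecolon_le le (h mu Jmu).
by exists k; rewrite nE mE.
Qed.

End ReesMonoid.

(** * Noetherianity *)

Lemma mlead_sub_lt (R : idomainType) (n : nat) (p q : {mpoly R[n]}) :
  mlead p = mlead q -> mleadc p = mleadc q -> p - q != 0 ->
  (mlead (p - q) < mlead p)%O.
Proof.
move=> e ec pq0; rewrite lt_neqAle; apply/andP; split; last first.
  by apply: le_trans (mleadB_le p q) _; rewrite -e joinxx.
apply/eqP => h; move: pq0; rewrite -mleadc_eq0 h mcoeffB ec e subrr.
by rewrite eqxx.
Qed.

Lemma mleadM (R : idomainType) (n : nat) (p q : {mpoly R[n]}) :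
  p != 0 -> q != 0 -> mlead (p * q) = (mlead p + mlead q)%MM.
Proof. by move=> p0 q0; rewrite mleadM_proper // mulf_neq0 ?mleadc_eq0. Qed.

Section SupportRing.
Variables (K : fieldType) (d r : nat).
Local Notation A := {mpoly {mpoly K[d]}[r]}.
Variable Mo : ('I_r -> nat) -> 'X_{1..d} -> Prop.
Hypothesis fgM : fg (fun x => Mo (nvec x) (mvec x)).

(** The monoid algebra of [Mo] over [K], seen inside [R[t]]. *)
Definition sring (P : A) : Prop :=
  forall (n : 'X_{1..r}) m, m \in msupp (P@_n) -> Mo n m.

Lemma Mo_fg (n : 'X_{1..r}) m :
  Mo n m <-> (fun x => Mo (nvec x) (mvec x)) (vec n m).
Proof. by rewrite /= mvec_vec. Qed.

Lemma MoD (n n' : 'X_{1..r}) m m' : Mo n m -> Mo n' m' -> Mo (n + n')%MM (m + m')%MM.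
Proof.
move=> /Mo_fg h /Mo_fg h'; apply/Mo_fg.
have -> : vec (n + n')%MM (m + m')%MM = vadd (vec n m) (vec n' m').
  rewrite -vec_add; congr vec; apply: functional_extensionality => i.
  exact: mnmDE.
exact: (fg_add fgM).
Qed.

Lemma Mo0 : Mo (0%MM : 'X_{1..r}) 0%MM.
Proof.
apply/Mo_fg.
have -> : vec (0%MM : 'X_{1..r}) 0%MM = @vzero ('I_r + 'I_d).
  by apply: functional_extensionality => -[i|j] /=; rewrite mnm0E.
exact: (fg_zero fgM).
Qed.

Lemma sring0 : sring 0.
Proof. by move=> n m; rewrite mcoeff0 msupp0. Qed.

Lemma sringD P Q : sring P -> sring Q -> sring (P + Q).
Proof.
move=> hP hQ n m; rewrite mcoeffD => /msuppD_le; rewrite mem_cat.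
by case/orP => [/hP|/hQ].
Qed.

Lemma sringN P : sring P -> sring (- P).
Proof. by move=> hP n m; rewrite mcoeffN (perm_mem (msuppN _)) => /hP. Qed.

Lemma sringM P Q : sring P -> sring Q -> sring (P * Q).
Proof.
move=> hP hQ n m; rewrite mcoeffM => /msupp_sum_le /flattenP [s].
move=> /mapP [[k1 k2]]; rewrite mem_filter /= => /andP[/eqP nE _] ->.
move=> /msuppM_le /allpairsP [[m1 m2] /= [/hP h1 /hQ h2 ->]].
by rewrite nE; exact: MoD.
Qed.

Lemma sring_mono (c : K) (n : 'X_{1..r}) m : Mo n m ->
  sring ((c *: 'X_[m] : {mpoly K[d]}) *: 'X_[n]).
Proof.
move=> Mnm n' m'; rewrite mcoeffZ mcoeffX; case: eqP => [<-|_].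
  by rewrite mulr1 => /msuppZ_le; rewrite msuppX mem_seq1 => /eqP ->.
by rewrite mulr0 msupp0.
Qed.

Lemma sring1 : sring 1.
Proof.
have := @sring_mono 1 _ _ Mo0; rewrite scale1r mpolyX0 scale1r.
by rewrite mpolyX0.
Qed.

Lemma sring_subring : is_subring sring.
Proof.
split; [exact: sring0 | exact: sring1 | | exact: sringM].
by move=> a b ha hb; apply: sringD => //; exact: sringN.
Qed.

(* Division with respect to the leading exponents [(mlead P, mlead (mleadc P))];
   those of an ideal form an ideal of the monoid, which is finitely generated. *)
Lemma sring_noetherian : noetherian_subring sring.
Proof.
move=> L [LS L0 LD LM].
pose lead (P : A) := vec (mlead P) (mlead (mleadc P)).
pose E x := exists P, [/\ L P, P != 0 & x = lead P].
have nzc (P : A) : P != 0 -> mleadc P != 0 by rewrite mleadc_eq0.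
have [||k [e [eE eP]]] := fg_ideal (E := E) fgM.
- move=> _ [P [LP P0 ->]]; rewrite /lead mvec_vec.
  by apply: (LS P LP); apply: mlead_supp; exact: nzc.
- move=> _ y [P [LP P0 ->]] My.
  pose N := [multinom nvec y i | i < r].
  have NE : (N : 'I_r -> nat) = nvec y.
    by apply: functional_extensionality => i; rewrite mnmE.
  have MN : Mo N (mvec y) by rewrite NE.
  (* Multiplication by the monomial with exponents [y] shifts the leading exponents by [y]. *)
  pose Y : A := (1 *: 'X_[mvec y] : {mpoly K[d]}) *: 'X_[N].
  have Xn0 : 'X_[mvec y] != 0 :> {mpoly K[d]}.
    by rewrite -msupp_eq0 msuppX.
  have Yl : mlead Y = N by rewrite /Y /mlead msuppMCX ?scale1r // big_seq1.
  have Yc : mleadc Y = 'X_[mvec y].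
    by rewrite Yl /Y mcoeffZ mcoeffX eqxx mulr1 scale1r.
  have Y0 : Y != 0 by rewrite -mleadc_eq0 Yc.
  exists (Y * P); split; [exact: LM (@sring_mono 1 _ _ MN) LP | by rewrite mulf_neq0 |].
  rewrite /lead mleadM // mleadcM Yc Yl mleadM ?nzc // mleadXm.
  rewrite -[y in LHS]vecK vaddC -vec_add -NE; congr vec.
  by apply: functional_extensionality => i; rewrite mnmDE.
have [Ps PsP] := fin_all_exists eE.
have span P : L P -> exists c : 'I_k -> A,
    (forall i, sring (c i)) /\ P = \sum_i c i * Ps i.
  have [n] : exists n, n = mlead P by eexists.
  (* Lexicographic induction: first on the leading exponent in the variables [t], then on the
     leading exponent of the leading coefficient. *)
  elim/(well_founded_ind (@ltom_wf r)): n P => n IHn P.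
  have [m] : exists m, m = mlead (mleadc P) by eexists.
  elim/(well_founded_ind (@ltom_wf d)): m P => m IHm P mE nE LP.
  have [->|P0] := eqVneq P 0.
    exists (fun=> 0); split=> [_|]; first exact: sring0.
    by rewrite big1 // => i _; rewrite mul0r.
  have [i [y [My lE]]] := eP (lead P) (ex_intro _ P (And3 LP P0 erefl)).
  have [LPi Pi0 ei] := PsP i.
  pose N := [multinom nvec y i | i < r].
  have NE : (N : 'I_r -> nat) = nvec y.
    by apply: functional_extensionality => i'; rewrite mnmE.
  have MN : Mo N (mvec y) by rewrite NE.
  have nN : mlead P = (N + mlead (Ps i))%MM.
    apply/mnmP => j; have := congr1 (@^~ (inl j)) lE.
    by rewrite ei /vadd /= mnmDE mnmE addnC.
  have mN : mlead (mleadc P) = (mvec y + mlead (mleadc (Ps i)))%MM.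
    apply/mnmP => j; have := congr1 (@^~ (inr j)) lE.
    by rewrite ei /vadd /= mnmDE mnmE addnC.
  pose a := mleadc (mleadc P); pose b := mleadc (mleadc (Ps i)).
  have a0 : a != 0 by rewrite mleadc_eq0 nzc.
  have b0 : b != 0 by rewrite mleadc_eq0 nzc.
  have ab0 : a / b != 0 by rewrite mulf_neq0 // invr_eq0.
  (* With this factor [Q * Ps i] agrees with [P] in both leading exponents and in the leading
     scalar. *)
  pose q : {mpoly K[d]} := (a / b) *: 'X_[mvec y].
  have ql : mlead q = mvec y by rewrite /q /mlead msuppMCX // big_seq1.
  have qc : mleadc q = a / b by rewrite ql mcoeffZ mcoeffX eqxx mulr1.
  have q0 : q != 0 by rewrite -mleadc_eq0 qc.
  pose Q : A := q *: 'X_[N].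
  have Ql : mlead Q = N by rewrite /Q /mlead msuppMCX // big_seq1.
  have Qc : mleadc Q = q by rewrite Ql mcoeffZ mcoeffX eqxx mulr1.
  have Q0 : Q != 0 by rewrite -mleadc_eq0 Qc.
  have SQ : sring Q by exact: sring_mono.
  have QPl : mlead (Q * Ps i) = mlead P by rewrite mleadM // Ql nN.
  have QPc : mleadc (Q * Ps i) = q * mleadc (Ps i) by rewrite mleadM // mleadcM Qc.
  have LQP : L (Q * Ps i) by apply: LM.
  pose P' := P - Q * Ps i.
  have LP' : L P'.
    apply: LD => //; rewrite -mulN1r; apply: LM => //.
    by apply: sringN; exact: sring1.
  have [c [cS cE]] : exists c : 'I_k -> A,
      (forall i, sring (c i)) /\ P' = \sum_i c i * Ps i.
    have [P'0|P'0] := eqVneq P' 0.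
      exists (fun=> 0); split=> [_|]; first exact: sring0.
      by rewrite P'0 big1 // => i' _; rewrite mul0r.
    (* Either the exponent in [t] drops, or it stays and the leading terms of the leading
       coefficients cancel. *)
    have : (mlead P' <= mlead P)%O.
      by apply: le_trans (mleadB_le _ _) _; rewrite QPl joinxx.
    rewrite le_eqVlt => /orP[/eqP P'l|P'lt]; last first.
      by apply: (IHn (mlead P')) => //; rewrite nE.
    have P'c : mleadc P' = mleadc P - q * mleadc (Ps i).
      by rewrite P'l mcoeffB -QPc QPl.
    apply: (IHm (mlead (mleadc P'))) => //; last by rewrite P'l.
    rewrite mE P'c; apply: mlead_sub_lt.
    - by rewrite mleadM ?nzc // ql.
    - by rewrite [in RHS]mleadM ?nzc // mleadcM qc divfK.
    - by rewrite -P'c nzc.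
  exists (fun j => c j + (if j == i then Q else 0)); split.
    move=> j; apply: sringD => //; case: eqP => // _; exact: sring0.
  under eq_bigr => j _ do rewrite mulrDl.
  rewrite big_split /= -cE (bigD1 i) //= eqxx big1 ?addr0 ?subrK //.
  by move=> j /negbTE ->; rewrite mul0r.
exists [seq Ps i | i <- enum 'I_k]; split.
  move=> g /(list_In_nth 0) [j]; rewrite size_map => jlt <-.
  rewrite size_enum_ord in jlt.
  rewrite (nth_map (Ordinal jlt)) ?size_enum_ord //.
  by case: (PsP (nth (Ordinal jlt) (enum 'I_k) j)).
move=> P /span [c [cS ->]]; exists [seq c i | i <- enum 'I_k]; split.
- by rewrite !size_map.
- move=> g /(list_In_nth 0) [j]; rewrite size_map size_enum_ord => jlt <-.
  by rewrite (nth_map (Ordinal jlt)) ?size_enum_ord.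
- set gs := [seq Ps i | i <- _]; set cs := [seq c i | i <- _].
  rewrite -(big_mkord xpredT (fun i => cs`_i * gs`_i)) size_map size_enum_ord.
  rewrite big_mkord; apply: eq_bigr => i _.
  have nthE (F : 'I_k -> A) : [seq F j | j <- enum 'I_k]`_i = F i.
    by rewrite (nth_map i) ?size_enum_ord // nth_ord_enum.
  by rewrite !nthE.
Qed.
End SupportRing.

(** * Lengths of quotients of monomial ideals *)

Lemma count_lt (T : eqType) (p q : pred T) (s : seq T) x :
  (forall y, p y -> q y) -> x \in s -> q x -> ~~ p x ->
  (count p s < count q s)%N.
Proof.
move=> pq xs qx px; elim: s xs => //= y s IH; rewrite inE => /orP[/eqP <-|/IH h].
  by rewrite (negbTE px) qx add0n ltnS; apply: sub_count.
apply: leq_ltn_trans (_ : (q y + count p s < _)%N); last by rewrite ltn_add2l.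
by rewrite leq_add2r; case: (p y) (pq y) => // ->.
Qed.

Section Length.
Variables (K : fieldType) (d : nat).
Local Notation P := {mpoly K[d]}.
Local Notation mon := 'X_{1..d}.
Implicit Types (L I N : P -> Prop).

Definition leads L (m : mon) := exists f, [/\ L f, f != 0 & mlead f = m].

Lemma ideal_subC I f g (c : K) : is_ideal I -> I f -> I g -> I (f - c *: g).
Proof.
move=> [_ ID IM] If Ig; apply: ID => //.
by rewrite -scaleNr -mul_mpolyC; apply: IM.
Qed.

(** Were every leading exponent of [N] also one of [I], repeated cancellation of leading terms by
    elements of [I] would reduce each element of [N] to zero. *)
Lemma leads_strict I N : is_ideal I -> is_ideal N ->
  (forall f, I f -> N f) -> (exists f, N f /\ ~ I f) ->
  exists2 m, leads N m & ~ leads I m.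
Proof.
move=> iI iN IN [f [Nf nIf]]; apply: NNPP => h; apply: nIf.
have [m] : exists m, m = mlead f by eexists.
elim/(well_founded_ind (@ltom_wf d)): m f Nf => m IH f Nf mE.
have [->|f0] := eqVneq f 0; first by case: iI.
have [g [Ig g0 gl]] : leads I (mlead f).
  by apply: NNPP => nI; apply: h; exists (mlead f) => //; exists f.
pose c := mleadc f / mleadc g.
have gc0 : mleadc g != 0 by rewrite mleadc_eq0.
have c0 : c != 0 by rewrite mulf_neq0 ?invr_eq0 // mleadc_eq0.
pose f' := f - c *: g.
have If' : I f'.
  have [->|f'0] := eqVneq f' 0; first by case: iI.
  apply: (IH (mlead f')) => //; last by apply: ideal_subC => //; exact: IN.
  rewrite mE; apply: mlead_sub_lt => //.
    by rewrite -mul_mpolyC mleadM ?mpolyC_eq0 // mleadC add0m.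
  rewrite -mul_mpolyC [in RHS]mleadM ?mpolyC_eq0 // mleadcM mleadcC.
  by rewrite /c divfK.
have -> : f = f' - (- c) *: g by rewrite scaleNr opprK subrK.
exact: ideal_subC.
Qed.

(** Adjoining the monomials of [ms] one at a time gives a chain. Conversely each step of any chain
    adds a leading exponent by [leads_strict]; it lies in [E'] and, since those of [E] are present
    from the start, in [ms]. *)
Lemma quot_length_count I N (E E' : mon -> Prop) (ms : seq mon) :
  expset I E -> expset N E' -> (forall m, E m -> E' m) -> uniq ms ->
  (forall m, m \in ms <-> E' m /\ ~ E m) -> quot_length I N (size ms).
Proof.
move=> [uE IE] [uE' NE'] EE' ums msP; split.
  pose ge_m (a b : mon) := (b <= a)%O.
  (* In decreasing monomial order every multiple of a monomial comes before it, so each initial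
     segment together with [E] is closed upwards. *)
  pose s := sort ge_m ms.
  have sP m : m \in s <-> E' m /\ ~ E m by rewrite mem_sort msP.
  have ss : sorted ge_m s by apply: sort_sorted => a b; exact: le_total.
  have us : uniq s by rewrite sort_uniq.
  have szs : size s = size ms by rewrite size_sort.
  have tr : transitive ge_m by move=> a b c h1 h2; exact: le_trans h2 h1.
  exists (fun j => mideal (fun m => E m \/ m \in take j s)); split.
  - move=> j _; apply: mideal_ideal => m m' [Em|mj]; first by left; apply: uE.
    have ms' := mem_take mj; have [E'm nEm] := (sP m).1 ms'.
    case: (classic (E (m + m')%MM)) => [|nE]; [by left | right].
    have mm's : (m + m')%MM \in s by apply/sP; split=> //; apply: uE'.
    rewrite in_take //; rewrite in_take // in mj; apply: leq_ltn_trans mj.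
    rewrite leqNgt; apply/negP => lt.
    have := sorted_ltn_index tr ss m (m + m')%MM ms' mm's lt; rewrite /ge_m => le.
    have e : (m + m')%MM = m by apply/eqP; rewrite eq_le le lemc_addr.
    by rewrite e ltnn in lt.
  - by move=> f; rewrite IE take0; split=> h m /h; [case | left].
  - move=> f; rewrite NE' -szs take_size; split=> h m /h.
      by case=> [/EE'|/sP []].
    move=> E'm; case: (classic (E m)) => [|nE]; [by left | right].
    exact/sP.
  - move=> j jlt; rewrite -szs in jlt; split.
      move=> f h m /h [|mj]; [by left | right].
      by rewrite (take_nth 0%MM) // mem_rcons inE mj orbT.
    pose m := nth 0%MM s j.
    have mS : m \in s by exact: mem_nth.
    exists 'X_[m]; rewrite !midealX; split.
      by right; rewrite (take_nth 0%MM) // mem_rcons inE eqxx.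
    case=> [|]; first by have [] := (sP m).1 mS.
    by rewrite in_take // index_uniq // ltnn.
move=> k [L [Li L0 Lk Ls]].
have sub j j' f : (j <= j' <= k)%N -> L j f -> L j' f.
  elim: j' => [|j' IH] /andP[]; first by rewrite leqn0 => /eqP ->.
  rewrite leq_eqVlt => /orP[/eqP ->//|jj'] j'k Lf.
  by apply: (Ls j' j'k).1; apply: IH => //; rewrite -ltnS jj' ltnW.
suff h j : (j <= k)%N -> (j <= count (fun m => asb (leads (L j) m)) ms)%N.
  exact: leq_trans (h k (leqnn _)) (count_size _ _).
elim: j => // j IH jk; apply: leq_ltn_trans (IH (ltnW jk)) _.
have [sj ex] := Ls j jk.
have [m lm nlm] := leads_strict (Li j (ltnW jk)) (Li j.+1 jk) sj ex.
apply: (@count_lt _ _ _ _ m); [|apply/msP|exact/asbP|exact/asbP].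
  by move=> y /asbP [f [Lf f0 fl]]; apply/asbP; exists f; split=> //; apply: sj.
split.
  have [f [Lf f0 <-]] := lm.
  have /Lk /NE' : L k f by apply: sub Lf; rewrite jk leqnn.
  by apply; apply: mlead_supp.
move=> Em; apply: nlm; exists 'X_[m]; rewrite mleadXm; split=> //.
  by apply: (sub 0%N); [rewrite (ltnW jk) | apply/L0/IE/midealX].
by rewrite -msupp_eq0 msuppX.
Qed.

End Length.

(** * The symbolic multi-Rees algebra as a monoid algebra *)

Lemma sym_multi_rees_sring (K : fieldType) (d r : nat)
    (Is : 'I_r -> {mpoly K[d]} -> Prop) (J : {mpoly K[d]} -> Prop)
    (Es : 'I_r -> 'X_{1..d} -> Prop) :
  (forall i, expset (Is i) (Es i)) ->
  sym_multi_rees Is J = sring (symrees Es J).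
Proof.
move=> IE; apply: functional_extensionality => p.
apply: propositional_extensionality.
have satE (n : 'X_{1..r}) :
    expset (saturation (ideal_multipow Is (fun i => n i)) J) (symrees Es J n).
  exact/expset_saturation/(expset_multipow _ IE).
by split=> h n; [move=> m; apply/((satE n).2 _).1 | apply/(satE n).2 => m /h].
Qed.

(** * The length function for the maximal homogeneous ideal *)

Section Counting.
Variables (K : fieldType) (d r : nat) (Es : 'I_r -> 'X_{1..d} -> Prop).
Hypothesis uEs : forall i, upclosed (Es i).
Implicit Types (n : 'I_r -> nat).
Local Notation mR := (@max_homog_ideal K d).

(** If [m j] is at least [C |n|], choose [k] such that [m + k e_j] lies in the Rees monoid. A
    bounded [p] below it satisfies [p j <= C |n| <= m j], so [p] lies below [m] already. *)
Lemma symrees_box : exists C : nat, forall n m,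
  symrees Es mR n m -> ~ rees Es n m -> forall j, (m j < C * \sum_(i < r) n i)%N.
Proof.
have [C CP] := rees_bounded Es; exists C => n m sm nm j.
rewrite ltnNge; apply/negP => le; apply: nm.
have [k /CP [p [pm rp pC]]] : ecolon (rees Es n) U_(j)%MM m.
  apply: sm; exists 'X_j; last by rewrite msuppX mem_seq1.
  by move=> L _; apply; exists j.
apply: upclosed_le rp; first exact: upclosed_emulti.
apply/mnm_lepP => i; have := mnm_lepP pm i; rewrite mnmDE mulmnE mnm1E.
by case: eqP => [<- _|_]; [exact: leq_trans (pC j) le | rewrite mul0n addn0].
Qed.

Definition boxvec n (sq : seq nat) : 'I_r + 'I_d -> nat :=
  fun t => updl (nenv n) r sq (split_idx t).

Lemma nvec_boxvec n sq : nvec (boxvec n sq) = n.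
Proof.
apply: functional_extensionality => i.
by rewrite /nvec /boxvec /= updl_lt // nenvE.
Qed.

Lemma mvec_boxvec n sq j : size sq = d -> mvec (boxvec n sq) j = nth 0%N sq j.
Proof. by move=> sz; rewrite mnmE /boxvec /= updl_nth // sz. Qed.

Definition length_count C n : nat :=
  count (fun sq => asb (symrees Es mR (nvec (boxvec n sq)) (mvec (boxvec n sq))) &&
      ~~ asb (rees Es (nvec (boxvec n sq)) (mvec (boxvec n sq))))
    (boxseq d (C * \sum_(i < r) nenv n i)).

(** Sequences in the box correspond to exponent vectors, and the second hypothesis puts every
    exponent to be counted inside the box. *)
Lemma quot_length_length_count C (Is : 'I_r -> {mpoly K[d]} -> Prop) n :
  (forall i, expset (Is i) (Es i)) ->
  (forall n m, symrees Es mR n m -> ~ rees Es n m ->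
    forall j, (m j < C * \sum_(i < r) n i)%N) ->
  quot_length (ideal_multipow Is n) (saturation (ideal_multipow Is n) mR)
    (length_count C n).
Proof.
move=> IE CP; rewrite /length_count; set pr := (fun sq => _); set bx := boxseq _ _.
have sumE : (\sum_(i < r) nenv n i = \sum_(i < r) n i)%N.
  by apply: eq_bigr => i _; rewrite nenvE.
rewrite -size_filter -(size_map (fun sq => mvec (boxvec n sq))).
have rE := expset_multipow n IE.
apply: quot_length_count rE (expset_saturation _ rE) _ _ _.
- move=> m Em mu _; exists 0%N; rewrite addm0 //.
- rewrite map_inj_in_uniq ?filter_uniq ?uniq_boxseq // => s s'.
  rewrite !mem_filter !mem_boxseq => /and3P[_ /eqP sz _] /and3P[_ /eqP sz' _] h.
  apply: (@eq_from_nth _ 0%N) => [|i]; rewrite sz ?sz' // => id.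
  by rewrite -(mvec_boxvec n (Ordinal id) sz) h mvec_boxvec.
move=> m; split.
  case/mapP => sq; rewrite mem_filter => /andP[/andP[]].
  by rewrite nvec_boxvec => /asbP h1 /asbP h2 _ ->.
move=> [h1 h2]; pose sq := [seq m j | j <- enum 'I_d].
have sz : size sq = d by rewrite size_map size_enum_ord.
have mE : mvec (boxvec n sq) = m.
  apply/mnmP => j; rewrite mvec_boxvec // (nth_map j) ?size_enum_ord //.
  by rewrite nth_ord_enum.
apply/mapP; exists sq => //; rewrite mem_filter mem_boxseq sz eqxx /=.
apply/andP; split; first by rewrite /pr nvec_boxvec mE; apply/andP; split; apply/asbP.
apply/allP => _ /mapP[j _ ->]; rewrite sumE; exact: CP.
Qed.

Lemma piecewise_length_count C :
  piecewise_quasi_poly (fun n => (length_count C n)%:R : rat).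
Proof.
exact: nfun_piecewise (nfun_count C (fg_symrees uEs mR) (fg_rees uEs)).
Qed.

Lemma length_count_le C n : (length_count C n <= (C * \sum_(i < r) n i) ^ d)%N.
Proof.
apply: leq_trans (count_size _ _) _; rewrite size_boxseq.
by under eq_bigr => i _ do rewrite nenvE.
Qed.

End Counting.

(** * The polynomial bound and the conclusion *)

(** For nonzero polynomials [msize] is the total degree plus one, so [2] and [k.+1] stand for
    degrees [1] and [k]. *)
Lemma msize_exp_le (R : nzRingType) (r : nat) (p : {mpoly R[r]}) (k : nat) :
  (msize p <= 2)%N -> (msize (p ^+ k) <= k.+1)%N.
Proof.
move=> p2; rewrite msizeE; apply/bigmax_leqP_seq => m + _.
rewrite ltnS; elim: k m => [|k IH] m.
  by rewrite expr0 msupp1 mem_seq1 => /eqP ->; rewrite mdeg0.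
rewrite exprS => /msuppM_le /allpairsP[[a b] /= [ap bk ->]].
rewrite mdegD -add1n leq_add ?IH //.
by rewrite -ltnS; apply: leq_trans (msize_mdeg_lt ap) p2.
Qed.

(** [Q] is the [d]-th power of the linear form [C (X_1 + ... + X_r)], whose integer coefficients
    give integer values. *)
Lemma linear_power_bound (r d C : nat) : exists Q : {mpoly rat[r]},
  [/\ numerical_poly Q, (msize Q <= d.+1)%N &
      forall n : 'I_r -> nat,
        Q.@[fun i => (n i)%:R] = ((C * \sum_(i < r) n i) ^ d)%:R].
Proof.
pose Q1 : {mpoly rat[r]} := C%:R *: \sum_(i < r) 'X_i.
have Q1E v : Q1.@[v] = C%:R * \sum_(i < r) v i.
  rewrite mevalZ raddf_sum; congr (_ * _); apply: eq_bigr => i _.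
  exact: mevalXU.
exists (Q1 ^+ d); split.
- move=> z; exists ((C%:R * \sum_(i < r) z i) ^+ d).
  rewrite rmorphXn /= Q1E rmorphXn rmorphM /= rmorph_nat.
  by rewrite rmorph_sum.
- apply: msize_exp_le; apply: leq_trans (mmeasureZ_le _ _ _) _.
  apply: leq_trans (mmeasure_sum _ _ _ _) _.
  by apply/bigmax_leqP => i _; rewrite mmeasureX /= mdeg1.
- by move=> n; rewrite rmorphXn /= Q1E natrX natrM natr_sum.
Qed.

Theorem theorem1p2 (K : fieldType) (d r : nat)
  (Is : 'I_r -> {mpoly K[d]} -> Prop) (J : {mpoly K[d]} -> Prop) :
  (forall i, is_ideal (Is i)) ->
  (forall i, monomial_ideal (Is i)) ->
  is_ideal J ->
  [/\ is_subring (sym_multi_rees Is J),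
      (forall c : {mpoly K[d]}, sym_multi_rees Is J c%:MP),
      noetherian_subring (sym_multi_rees Is J) &
      ((forall f, J f <-> max_homog_ideal f) ->
       exists F : ('I_r -> nat) -> nat,
         [/\ piecewise_quasi_poly (fun n => (F n)%:R : rat),
             (exists c : nat, forall n : 'I_r -> nat, (forall i, (c <= n i)%N) ->
                quot_length (ideal_multipow Is n)
                  (saturation (ideal_multipow Is n) (@max_homog_ideal K d)) (F n)) &
             (exists Q : {mpoly rat[r]},
                [/\ numerical_poly Q, (msize Q <= d.+1)%N &
                    exists c : nat, forall n : 'I_r -> nat, (forall i, (c <= n i)%N) ->
                      (F n)%:R <= Q.@[fun i => (n i)%:R]])])].
Proof.
move=> _ Imon _.
have [Es IE] := fin_all_exists (fun i => monomial_expset (Imon i)).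
have uEs i : upclosed (Es i) := (IE i).1.
rewrite (sym_multi_rees_sring J IE).
have fgS := fg_symrees uEs J.
split; [exact: sring_subring | | exact: sring_noetherian |].
  (* Constants live in degree zero, where the product of powers is the unit ideal and every exponent
     is allowed. *)
  move=> c n m; rewrite mcoeffC; case: eqP => [->|_]; last first.
    by rewrite mulr0 msupp0.
  by move=> _ mu _; exists 0%N; apply: emulti0 => i _; rewrite mnm0E.
move=> _; have [C CP] := symrees_box K uEs.
exists (length_count K Es C); split.
- exact: piecewise_length_count.
(* The count and the bound below hold in every degree, so [0] serves as threshold. *)
- by exists 0%N => n _; exact: quot_length_length_count.
- have [Q [Qnum Qsize QE]] := linear_power_bound r d C.
  exists Q; split=> //; exists 0%N => n _.
  by rewrite QE ler_nat; exact: length_count_le.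
Qed.
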